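(* Suppose that $H'(\mu^1)\le1$. Let $\varsigma$ be the law of $C_\emptyset$, where $C$ is the unique endogenous solution of the RDE, and let $b(\mu^1)=\{m\in[0,1]: f^{n}(m)\to\mu^1 \text{ as } n\to\infty\}$ be the basin of attraction of $\mu^1$ under the iterative map for the first moment $f:t\mapsto 1-H(t)$ on $[0,1]$, where $f^n$ is the $n$-fold composition of $f$. Then $$B(\varsigma)=\Big\{\nu\in\mathcal P:\ \int x\,d\nu(x)\in b(\mu^1)\Big\}.$$
   Context: $N$ is a random variable with values in $\{1,2,\dots\}\cup\{\infty\}$, and $H(s)=\mathbb E[s^N]$ for $s\in[0,1]$, with conventions $s^\infty=0$ for $0\le s<1$ and $1^\infty=1$; in particular $H(0)=0$. Standing assumption: $H$ is strictly convex (on $[0,1)$), i.e. $\mathbb P(2\le N<\infty)>0$. $\mu^1$ is the unique root in $(0,1)$ of $H(x)+x=1$. $\mathcal P$ is the set of probability measures on $[0,1]$. The map $\mathcal T:\mathcal P\to\mathcal P$ sends $\nu$ to the law of $1-\prod_{i=1}^N X_i$, where $X_1,X_2,\dots$ are i.i.d. with law $\nu$ and independent of $N$ (an infinite product is the limit of its partial products). For a fixed point $\pi$ of $\mathcal T$, the basin of attraction is $B(\pi)=\{\nu\in\mathcal P:\mathcal T^n(\nu)\to\pi\text{ weakly as }n\to\infty\}$. $\mathbf T=\bigcup_{n\ge0}\mathbb N^n$ is the tree of finite sequences of positive integers, $\emptyset$ its root, $|u|$ the length of $u$, and $u1,u2,\dots$ the daughters of $u$; $(N_u;u\in\mathbf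 T)$ are i.i.d. copies of $N$. A tree-indexed solution to the RDE is a family $(X_u;u\in\mathbf T)$ of $[0,1]$-valued random variables such that (i) for every $n$ the $(X_u;|u|=n)$ are mutually independent and independent of $(N_v;|v|\le n-1)$; (ii) for every $u$, $X_u=1-\prod_{i=1}^{N_u}X_{ui}$, and all the $X_u$ have the same law. It is endogenous if it is measurable with respect to (the completion of) $\sigma(N_u;u\in\mathbf T)$. There is an (a.s.) unique endogenous solution $C=(C_u;u\in\mathbf T)$; it is given by $C_u=\mathbb P(S_u=1\mid N_v;v\in\mathbf T)$, where $S$ is the tree-indexed solution with values in $\{0,1\}$ and $\mathbb P(S_u=1)=\mu^1$. *)

(* Defs.v *)
From HB Require Import structures.
From mathcomp Require Import all_boot all_order all_algebra.
From mathcomp Require Import all_classical all_reals all_analysis.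
From mathcomp Require Import measurable_realfun.

Set Implicit Arguments.
Unset Strict Implicit.
Unset Printing Implicit Defensive.

Import Order.TTheory GRing.Theory Num.Theory.
Import numFieldNormedType.Exports.

Local Open Scope classical_set_scope.
Local Open Scope ring_scope.

(* N-values: [Some n] is the finite value n and [None] is infinity; the
   sigma-algebra is discrete. The value 0 is excluded by [offspring_law]. *)
Definition enat : Type := option nat.

HB.instance Definition _ := Pointed.on enat.
HB.instance Definition _ := @isMeasurable.Build default_measure_display
  enat discrete_measurable discrete_measurable0
  discrete_measurableC discrete_measurableU.

Definition offspring_law (R : realType) (p : probability enat R) : Prop :=
  p [set Some 0%N] = 0%E.

(* s^N with s^oo = 0 for 0 <= s < 1 and 1^oo = 1 *)
Definition epow (R : realType) (s : R) (k : enat) : R :=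
  if k is Some n then s ^+ n else if s == 1 then 1 else 0.

(* x_1 * ... * x_k; the sequence is indexed from 0, so [x i] is x_{i+1} *)
Definition eprod (R : realType) (k : enat) (x : nat -> R) : R :=
  if k is Some n then \prod_(i < n) x i
  else limn (fun n => \prod_(i < n) x i).

Definition genfun (R : realType) (p : probability enat R) (s : R) : R :=
  fine 'E_p[epow s].

Definition strictly_convex_on (R : realType) (D : set R) (f : R -> R) : Prop :=
  forall x y t, D x -> D y -> x != y -> 0 < t < 1 ->
    f (t * x + (1 - t) * y) < t * f x + (1 - t) * f y.

Definition has_law d d' (T : measurableType d) (T' : measurableType d')
    (R : realType) (P : probability T R) (X : T -> T')
    (nu : probability T' R) : Prop :=
  forall A, measurable A -> P (X @^-1` A) = nu A.

Definition mutually_independent d d' (T : measurableType d)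
    (T' : measurableType d') (R : realType) (P : probability T R)
    (I : choiceType) (D : set I) (X : I -> T -> T') : Prop :=
  forall (s : seq I) (A : I -> set T'), uniq s ->
    (forall i, i \in s -> D i) -> (forall i, measurable (A i)) ->
    P (\bigcap_(i in [set` s]) X i @^-1` A i) =
      (\prod_(i <- s) P (X i @^-1` A i))%E.

Definition sigma_gen d d' (T : measurableType d) (T' : measurableType d')
    (I : Type) (D : set I) (X : I -> T -> T') : set (set T) :=
  \bigcup_(i in D) preimage_set_system setT (X i) measurable.

Definition sigma_indep d (T : measurableType d) (R : realType)
    (P : probability T R) (F G : set (set T)) : Prop :=
  forall A B, F A -> G B -> P (A `&` B) = (P A * P B)%E.

Definition prob01 (R : realType) : set (probability R R) :=
  [set nu : probability R R | nu `[0, 1]%classic = 1%E].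

(* nu' is the law of 1 - X_1 ... X_N with the X_i i.i.d. of law nu and
   independent of N, N of law p *)
Definition RDE_image (R : realType) (p : probability enat R)
    (nu nu' : probability R R) : Prop :=
  exists (d : measure_display) (T : measurableType d) (Q : probability T R)
         (N : {RV Q >-> enat}) (X : nat -> {RV Q >-> R}),
    [/\ has_law Q N p,
        forall i, has_law Q (X i) nu /\ (forall w, 0 <= X i w <= 1),
        mutually_independent Q setT (fun i => X i : T -> R),
        sigma_indep Q <<s sigma_gen setT (fun i => X i : T -> R) >>
                      <<s sigma_gen setT (fun _ : unit => N : T -> enat) >> &
        has_law Q (fun w => 1 - eprod (N w) (fun i => X i w)) nu'].

(* Every nu in [prob01] has an image, unique as a measure on Borel sets; the
   default [nu] is only met outside [prob01]. *)
Definition RDE_map (R : realType) (p : probability enat R)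
    (nu : probability R R) : probability R R :=
  xget nu [set nu' | RDE_image p nu nu'].

Definition weakly_cvg01 (R : realType) (nu_ : nat -> probability R R)
    (pi : probability R R) : Prop :=
  forall f : R -> R, {within `[0, 1], continuous f} ->
    (\int[nu_ n]_(x in `[0, 1]) f x)%R @[n --> \oo]
      --> (\int[pi]_(x in `[0, 1]) f x)%R.

Definition basin (R : realType) (p : probability enat R)
    (pi : probability R R) : set (probability R R) :=
  [set nu | prob01 nu /\ weakly_cvg01 (fun n => iter n (RDE_map p) nu) pi].

Definition mean01 (R : realType) (nu : probability R R) : R :=
  (\int[nu]_(x in `[0, 1]) x)%R.

Definition moment_basin (R : realType) (p : probability enat R) (m0 : R) :
    set R :=
  [set m | 0 <= m <= 1 /\
           iter n (fun t => 1 - genfun p t) m @[n --> \oo] --> m0].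

(* The letter i stands for the positive integer i+1: the daughters u1, u2, ...
   of u are [rcons u 0], [rcons u 1], ... and |u| is [size u]. *)
Definition tree : Type := seq nat.
HB.instance Definition _ := Choice.on tree.

Definition iid_copies d (T : measurableType d) (R : realType)
    (P : probability T R) (p : probability enat R)
    (N : tree -> {RV P >-> enat}) : Prop :=
  mutually_independent P setT (fun u => N u : T -> enat) /\
  forall u, has_law P (N u) p.

Record tree_solution d (T : measurableType d) (R : realType)
    (P : probability T R) (N : tree -> {RV P >-> enat})
    (X : tree -> {RV P >-> R}) : Prop := TreeSolution {
  sol_in01 : forall u w, 0 <= X u w <= 1 ;
  sol_indep : forall n : nat,
    mutually_independent P [set u | size u = n] (fun u => X u : T -> R) ;
  sol_indepN : forall n : nat,
    sigma_indep P
      <<s sigma_gen [set u | size u = n] (fun u => X u : T -> R) >>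
      <<s sigma_gen [set v | (size v < n)%N] (fun v => N v : T -> enat) >> ;
  sol_RDE : forall u, {ae P, forall w,
    X u w = 1 - eprod (N u w) (fun i => X (rcons u i) w)} ;
  sol_law : forall u v, has_law P (X u) (distribution P (X v))
}.

(* [completed_algebra_gen] is taken on the sigma-algebra generated by the
   N_u, so that its null sets are subsets of null sets of that sigma-algebra. *)
Definition endogenous d (T : measurableType d) (R : realType)
    (P : probability T R) (N : tree -> {RV P >-> enat})
    (X : tree -> {RV P >-> R}) : Prop :=
  let G := sigma_gen setT (fun u => N u : T -> enat) in
  forall u A, measurable A ->
    @completed_algebra_gen _ (g_sigma_algebraType G) R P (X u @^-1` A).

(* Main.v *)
(**
Taking conditional expectations in [x |-> 1 - x_1 ... x_N], the map [RDE_map]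
sends a law with first and second moments (m, r) to one with moments
(1 - H m, 1 - 2 H m + H r).  A fixed point has m = mu1 and r = 2 mu1 - 1 + H r,
an equation that r = mu1 solves.  By strict convexity and H'(mu1) <= 1 the chord
of H from any r < mu1 to mu1 has slope < 1, so r = mu1 is the only solution in
[0, mu1]: the law of the root is Bernoulli(mu1), the only law on [0,1] with
second moment equal to the mean mu1.

Along the orbit of any law, the means follow f = 1 - H, so weak convergence
forces the mean into the basin of mu1.  Conversely if the means converge to mu1,
the same slope bound forces the second moments to mu1, and E[X(1-X)] -> 0
together with E[X] -> mu1 gives weak convergence to Bernoulli(mu1).

An image law exists because an i.i.d. sequence with a given law can be extracted
from a single uniform variable by deinterleaving its binary digits.
*)

Require Import Defs.
From HB Require Import structures.
From mathcomp Require Import all_boot all_order all_algebra.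
From mathcomp Require Import all_classical all_reals all_analysis.
From mathcomp Require Import measurable_realfun ring lra.

Set Implicit Arguments.
Unset Strict Implicit.
Unset Printing Implicit Defensive.

Import Order.TTheory GRing.Theory Num.Theory.
Import numFieldNormedType.Exports.

Local Open Scope classical_set_scope.
Local Open Scope ring_scope.

(** * The uniform law and the splitting of binary digits *)

Lemma preimage_measurable d d' (T : measurableType d) (T' : measurableType d')
    (f : T -> T') (A : set T') :
  measurable_fun setT f -> measurable A -> measurable (f @^-1` A).
Proof. by move=> mf mA; rewrite -[X in measurable X]setTI; exact: mf. Qed.

(** Left rays are stable under intersection and generate the Borel sets; the rays ending at integers
    exhaust the line, which supplies the cover by sets of finite mass. *)
Lemma measure_unique_ray (R : realType) (m1 m2 : {measure set R -> \bar R}) :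
  (forall a, m1 `]-oo, a]%classic = m2 `]-oo, a]%classic) -> (forall a, (m1 `]-oo, a]%classic < +oo)%E) ->
  forall A, measurable A -> m1 A = m2 A.
Proof.
move=> m12 m1oo A mA.
apply: (measure_unique [set `]-oo, a]%classic | a in [set: R]]
  (fun n => `]-oo, n%:R]%classic)) => //.
- apply/seteqP; split; last first.
    apply: smallest_sub; first exact: sigma_algebra_measurable.
    by move=> _ [a _ <-]; exact: measurable_itv.
  move=> B mB.
  have : (@RGenOInfty.G R).-sigma.-measurable B by rewrite -RGenOInfty.measurableE.
  apply: smallest_sub; first exact: smallest_sigma_algebra.
  move=> _ [a ->]; rewrite -setCitvl.
  rewrite -setTD; have [_ + _] := @smallest_sigma_algebra R setT
    [set `]-oo, a]%classic | a in [set: R]].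
  by apply; apply: sub_sigma_algebra; exists a.
- move=> _ _ [a _ <-] [b _ <-]; exists (Num.min a b) => //.
  by apply/seteqP; split => x /=; rewrite !in_itv/= le_min => /andP.
- apply/seteqP; split => // x _; exists (Num.truncn x).+1 => //=.
  by rewrite in_itv/= ltW// truncnS_gt.
- by move=> _ [a _ <-].
Qed.

(** The distribution function of the uniform law on [0, 1]. *)
Definition clamp (R : realType) (a : R) := Num.max 0 (Num.min a 1).

Lemma clampE (R : realType) (a : R) : clamp a = if a < 0 then 0 else if a < 1 then a else 1.
Proof.
rewrite /clamp; case: (ltP a 0) => a0; first by rewrite max_l// ge_min (ltW a0).
by rewrite max_r// le_min a0 ler01.
Qed.

Lemma uniform_ray (R : realType) (a : R) :
  uniform_prob (@ltr01 R) `]-oo, a]%classic = (clamp a)%:E.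
Proof.
rewrite /uniform_prob integral_uniform_pdf.
rewrite (eq_integral (fun=> 1%E)); last first.
  by move=> x; rewrite inE/= /uniform_pdf !in_itv/= => -[_ ->]; rewrite subr0 invr1.
rewrite integral_cst//; last exact: measurableI.
have -> : `]-oo, a] `&` `[0, 1] = `[0, Num.min a 1]%classic :> set R.
  apply/seteqP; split => x /=; rewrite !in_itv/= le_min.
    by move=> [-> /andP[-> ->]].
  by move=> /and3P[-> -> ->].
rewrite mul1e /clamp.
have := @lebesgue_measure_itv R `[0, Num.min a 1]; rewrite /= => ->.
rewrite lte_fin; case: ltP => // _; by rewrite sube0.
Qed.

Lemma measurable_id_stieltjes (R : realType) :
  measurable_fun setT (idfun : measurableTypeR R -> R).
Proof. by move=> _ A mA; rewrite setTI preimage_id. Qed.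

(* [uniform_prob] lives on [measurableTypeR R], whose display differs from the
   one of [R]. *)
Definition unif (R : realType) : probability R R :=
  distribution (uniform_prob (@ltr01 R))
    (HB.pack_for {mfun measurableTypeR R >-> R} (idfun : measurableTypeR R -> R)
       (isMeasurableFun.Build _ _ _ _ _ (@measurable_id_stieltjes R))).

Lemma unif_ray (R : realType) (a : R) : unif R `]-oo, a]%classic = (clamp a)%:E.
Proof. by rewrite -uniform_ray. Qed.

Section splitting.
Context {R : realType}.
Variable Q : probability R R.
Hypothesis Q_ray : forall a, Q `]-oo, a]%classic = (clamp a)%:E.

Lemma clamp_dyadic (a : R) : clamp a = 2^-1 * (clamp (2 * a) + clamp (2 * a - 1)).
Proof. by rewrite !clampE; do ![case: ltP => ?]; lra. Qed.

(** Conditioning on the first binary digit: both sides are finite measures, and on rays they agree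
    by [clamp_dyadic]. *)
Lemma uniform_dyadic (A : set R) : measurable A ->
  Q A = (2^-1%:E * (Q ((fun y => y / 2)%R @^-1` A) +
                    Q ((fun y => (y + 1) / 2)%R @^-1` A)))%E.
Proof.
move=> mA.
have mh0 : measurable_fun setT (fun y : R => y / 2) by exact: mulrr_measurable.
have mh1 : measurable_fun setT (fun y : R => (y + 1) / 2).
  by apply: measurable_funM => //; apply: measurable_funD.
pose h0 : {RV Q >-> R} := HB.pack (fun y : R => y / 2) (isMeasurableFun.Build _ _ _ _ _ mh0).
pose h1 : {RV Q >-> R} := HB.pack (fun y : R => (y + 1) / 2) (isMeasurableFun.Build _ _ _ _ _ mh1).
have hh : 0 <= 2^-1 :> R by lra.
pose m2 := mscale (NngNum hh) (measure_add (distribution Q h0) (distribution Q h1)).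
have -> : (2^-1%:E * (Q ((fun y => y / 2)%R @^-1` A) + Q ((fun y => (y + 1) / 2)%R @^-1` A)))%E = m2 A.
  by rewrite /m2 /mscale; congr (_ * _)%E; exact/esym/measure_addE.
apply: measure_unique_ray => // a; last first.
  by rewrite (le_lt_trans (probability_le1 _ _))// ?ltry.
transitivity (2^-1%:E * (distribution Q h0 `]-oo, a] + distribution Q h1 `]-oo, a]))%E; last first.
  by rewrite /m2 /mscale; congr (_ * _)%E; exact/esym/measure_addE.
rewrite /distribution /pushforward.
have -> : (fun y => y / 2) @^-1` `]-oo, a] = `]-oo, 2 * a]%classic :> set R.
  by apply/seteqP; split => x /=; rewrite !in_itv/=; lra.
have -> : (fun y => (y + 1) / 2) @^-1` `]-oo, a] = `]-oo, 2 * a - 1]%classic :> set R.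
  by apply/seteqP; split => x /=; rewrite !in_itv/=; lra.
by rewrite !Q_ray -EFinD -EFinM -clamp_dyadic; exact: Q_ray.
Qed.

(** Since ]0, 1] has full mass, identities between binary digits need only hold there. *)
Lemma uniform_eq (A B : set R) : measurable A -> measurable B ->
  (forall x, 0 < x <= 1 -> A x <-> B x) -> Q A = Q B.
Proof.
move=> mA mB AB.
suff H (C : set R) : measurable C -> Q C = Q (C `&` `]0, 1]).
  rewrite H// [RHS]H//; congr (Q _).
  by apply/seteqP; split => x /= []; rewrite in_itv/= => Cx x01; split=> //; apply/(AB _ x01).
move=> mC.
have Q1 : Q `]0, 1]%classic = 1%E.
  have -> : `]0, 1]%classic = `]-oo, 1] `\` `]-oo, 0] :> set R.
    by apply/seteqP; split => x /=; rewrite !in_itv/=; lra.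
  rewrite measureD//=; last by rewrite (le_lt_trans (probability_le1 _ _))// ?ltry.
  have -> : `]-oo, 1] `&` `]-oo, 0] = `]-oo, 0]%classic :> set R.
    by apply/seteqP; split => x /=; rewrite !in_itv/=; lra.
  by rewrite !Q_ray -EFinB; congr EFin; rewrite !clampE; do ![case: ltP => ?]; lra.
have Q0 : Q (~` `]0, 1]%classic) = 0%E by rewrite probability_setC// Q1 subee.
apply/eqP; rewrite eq_le; apply/andP; split; last first.
  by apply: le_measure => //; rewrite ?inE//; exact: measurableI.
apply: (@le_trans _ _ (Q (C `&` `]0, 1] `|` ~` `]0, 1]))).
  apply: le_measure; rewrite ?inE//.
    by apply: measurableU; [exact: measurableI|exact: measurableC].
  by move=> x Cx; case: (pselect (`]0, 1]%classic x)) => ?; [left|right].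
have /= := @measureU2 _ _ _ Q (C `&` `]0, 1]) (~` `]0, 1]%classic).
rewrite Q0 adde0; apply; [exact: measurableI|exact: measurableC].
Qed.

(* Up to null sets, [x |-> (even_half x, even_half (dbl x))] deinterleaves the
   binary digits of [x]; it maps the uniform law to its square.  The convention
   [x <= 1/2] in [bit] and [dbl] suits ]0, 1], whose mass is read off rays. *)
Definition bit (x : R) : R := if x <= 2^-1 then 0 else 1.
Definition dbl (x : R) : R := if x <= 2^-1 then 2 * x else 2 * x - 1.

Fixpoint even_bits n (x : R) : R :=
  if n is m.+1 then (bit x + even_bits m (dbl (dbl x))) / 2 else 0.

Definition even_half (x : R) := limn (even_bits ^~ x).

Lemma bit_itv x : 0 <= bit x <= 1.
Proof. by rewrite /bit; case: ifP => _; lra. Qed.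

Lemma even_bits_itv n x : 0 <= even_bits n x <= 1.
Proof.
elim: n x => [|n IH] x /=; first by lra.
by have := IH (dbl (dbl x)); have := bit_itv x; lra.
Qed.

Lemma even_bits_nd x : nondecreasing_seq (even_bits ^~ x).
Proof.
apply/nondecreasing_seqP => n; elim: n x => [|n IH] x.
  by have /andP[] := even_bits_itv 1 x.
by rewrite /= -/(even_bits _ _); have := IH (dbl (dbl x)) => /=; lra.
Qed.

Lemma even_bits_cvg x : even_bits ^~ x @ \oo --> even_half x.
Proof.
apply: nondecreasing_is_cvgn; first exact: even_bits_nd.
by exists 1 => _ [n _ <-]; have /andP[] := even_bits_itv n x.
Qed.

Lemma even_half_itv x : 0 <= even_half x <= 1.
Proof.
apply/andP; split.
  by apply: (limr_ge (cvgP _ (@even_bits_cvg x))); near=> n; have /andP[] := even_bits_itv n x.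
by apply: (limr_le (cvgP _ (@even_bits_cvg x))); near=> n; have /andP[] := even_bits_itv n x.
Unshelve. all: by end_near. Qed.

Lemma even_halfE x : even_half x = (bit x + even_half (dbl (dbl x))) / 2.
Proof.
have h1 : even_bits n.+1 x @[n --> \oo] --> even_half x.
  by have := @even_bits_cvg x; rewrite -(@cvg_shiftS _ (even_bits ^~ x)).
have h2 : even_bits n.+1 x @[n --> \oo] --> (bit x + even_half (dbl (dbl x))) / 2.
  by apply: cvgM; [apply: cvgD; [exact: cvg_cst|exact: even_bits_cvg]|exact: cvg_cst].
exact: (cvg_unique _ h1 h2).
Qed.

Lemma measurable_bit : measurable_fun setT bit.
Proof. by apply: measurable_fun_ifT => //; exact: measurable_fun_ler. Qed.

Lemma measurable_dbl : measurable_fun setT dbl.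
Proof.
apply: measurable_fun_ifT; first exact: measurable_fun_ler.
  exact: mulrl_measurable.
by apply: measurable_funB => //; exact: mulrl_measurable.
Qed.

Lemma measurable_even_half : measurable_fun setT even_half.
Proof.
apply: (measurable_fun_cvg (h := even_bits)); last by move=> x _; exact: even_bits_cvg.
elim=> [|n IH] //=.
apply: measurable_funM => //; apply: measurable_funD; first exact: measurable_bit.
apply: (measurableT_comp IH); apply: measurableT_comp; exact: measurable_dbl.
Qed.

End splitting.

Lemma eq0_dyadic_bound (R : realType) (x : R) : (forall n, `|x| <= 2^-1 ^+ n) -> x = 0.
Proof.
move=> H; apply/eqP; rewrite -normr_le0.
have h : (2^-1 : R) ^+ n @[n --> \oo] --> 0.
  by apply: cvg_expr; rewrite ger0_norm; lra.
rewrite -(cvg_lim _ h)//; apply: limr_ge; first exact: (cvgP _ h).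
by near=> n; exact: H.
Unshelve. all: by end_near. Qed.

(* The refinement equation halves the error at each step, because for each [a]
   one of its two terms is governed by a boundary value. *)
Lemma dyadic_cdf_unique (R : realType) (D : R -> R -> R) :
  (forall a b, `|D a b| <= 1) ->
  (forall a b, D a b = 2^-1 * (D b (2 * a) + D b (2 * a - 1))) ->
  (forall a b, b < 0 -> D a b = 0) ->
  (forall a b, 1 <= b -> D a b = D a 1) ->
  D 1 1 = 0 ->
  forall a b, D a b = 0.
Proof.
move=> D1 rec D0 Db D11.
(* At [a = 1] the two terms are [D b 2] and [D b 1], which coincide; so the two boundary lines carry
   the same values. *)
have H1b b : D 1 b = D b 1.
  have := rec 1 b; have -> : 2 * 1 - 1 = 1 :> R by ring.
  have /Db -> : (1 : R) <= 2 * 1 by lra.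
  by move=> ->; field.
have D1b c : 1 <= c -> D 1 c = 0 by move=> /Db ->.
(* The line [b = 1] comes first: one of the two terms vanishes, and [H1b] returns the other to this
   line. *)
have M a n : `|D a 1| <= 2^-1 ^+ n.
  elim: n a => [|n IH] a; first by rewrite expr0.
  rewrite rec exprS normrM ger0_norm; last lra.
  rewrite ler_wpM2l//.
  case: (ltP a 2^-1) => ha.
    by rewrite (D0 1 (2 * a - 1)) ?addr0 ?H1b//; lra.
  by rewrite (D1b (2 * a)) ?add0r ?H1b//; lra.
have Ma a : D a 1 = 0 by apply: eq0_dyadic_bound => n; exact: M.
(* In general, either the second term vanishes or the first lies on the boundary line just
   treated. *)
have Mab a b n : `|D a b| <= 2^-1 ^+ n.
  elim: n a b => [|n IH] a b; first by rewrite expr0.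
  rewrite rec exprS normrM ger0_norm; last lra.
  rewrite ler_wpM2l//.
  case: (ltP a 2^-1) => ha.
    by rewrite (D0 b (2 * a - 1)) ?addr0//; lra.
  by rewrite (Db b (2 * a)) ?Ma ?add0r//; lra.
by move=> a b; apply: eq0_dyadic_bound => n; exact: Mab.
Qed.

(** * Independence of the two halves of the digits *)

Section splitting_law.
Context {R : realType}.
Variable Q : probability R R.
Hypothesis Q_ray : forall a, Q `]-oo, a]%classic = (clamp a)%:E.

Let E (a b : R) := [set x | even_half x <= a] `&` [set x | even_half (dbl x) <= b].

Let mu_le (f : R -> R) c : measurable_fun setT f -> measurable [set x | f x <= c].
Proof.
move=> mf; rewrite -[X in measurable X]setTI.
have -> : [set x | f x <= c] = f @^-1` `]-oo, c].
  by apply/seteqP; split => x /=; rewrite in_itv.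
by apply: mf => //; exact: measurable_itv.
Qed.

Let muh := @measurable_even_half R.
Let muhd : measurable_fun setT (even_half \o @dbl R).
Proof. by apply: measurableT_comp => //; exact: measurable_dbl. Qed.

Let mE a b : measurable (E a b).
Proof. by apply: measurableI; apply: mu_le. Qed.

Let G a b := fine (Q (E a b)).

Let QE a b : Q (E a b) = (G a b)%:E.
Proof. by rewrite /G fineK// fin_num_measure. Qed.

(** Prepending a binary digit to [y] exchanges even and odd places, hence the swapped arguments; the
    digit itself decides between the thresholds [2 * a] and [2 * a - 1]. *)
Let G_rec a b : G a b = 2^-1 * (G b (2 * a) + G b (2 * a - 1)).
Proof.
apply: EFin_inj; rewrite -QE (uniform_dyadic Q_ray)// EFinM EFinD -!QE.
have mh0 : measurable_fun setT (fun y : R => y / 2) by exact: mulrr_measurable.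
have mh1 : measurable_fun setT (fun y : R => (y + 1) / 2).
  by apply: measurable_funM => //; apply: measurable_funD.
congr (_ * (_ + _))%E; apply: (uniform_eq Q_ray) => //.
- by rewrite -[X in measurable X]setTI; exact: mh0.
- move=> y y01; rewrite /E/=.
  have dy : dbl (y / 2) = y by rewrite /dbl; case: ifP; lra.
  rewrite (even_halfE (y / 2)) dy /bit.
  have -> : y / 2 <= 2^-1 by lra.
  by rewrite add0r; split => -[h1 h2]; split => //; lra.
- by rewrite -[X in measurable X]setTI; exact: mh1.
- move=> y y01; rewrite /E/=.
  have hn : ((y + 1) / 2 <= 2^-1) = false by apply/negbTE; rewrite -ltNge; lra.
  have dy : dbl ((y + 1) / 2) = y by rewrite /dbl hn; lra.
  rewrite (even_halfE ((y + 1) / 2)) dy /bit hn.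
  by split => -[h1 h2]; split => //; lra.
Qed.

(** The product of two uniform distribution functions obeys the recursion of [G], by [clamp_dyadic],
    so the difference meets the criterion of [dyadic_cdf_unique]. *)
Let G_joint a b : Q (E a b) = (clamp a * clamp b)%:E.
Proof.
rewrite QE; congr EFin; apply/eqP; rewrite -subr_eq0; apply/eqP.
have G01 a' b' : 0 <= G a' b' <= 1.
  by rewrite -!lee_fin -QE measure_ge0 probability_le1.
have c01 (a' : R) : 0 <= clamp a' <= 1.
  by rewrite clampE; do ![case: ltP => ?]; lra.
have G11 a' b' : 1 <= b' -> G a' b' = G a' 1.
  move=> b1; apply: EFin_inj; rewrite -!QE; congr (Q _).
  apply/seteqP; split => x [/= h _]; split => //=;
    by have := even_half_itv (dbl x); lra.
apply: (@dyadic_cdf_unique R (fun a b => G a b - clamp a * clamp b)).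
- move=> a' b'; have /andP[a0 a1] := c01 a'; have /andP[b0 b1] := c01 b'.
  have h0 := mulr_ge0 a0 b0; have h1 := mulr_ile1 a0 b0 a1 b1.
  by have := G01 a' b'; rewrite ler_norml; lra.
- move=> a' b'; rewrite G_rec {1}clamp_dyadic; ring.
- move=> a' b' b0.
  have -> : clamp b' = 0 by rewrite clampE b0.
  rewrite mulr0 subr0; apply: EFin_inj; rewrite -QE (_ : E _ _ = set0) ?measure0//.
  by apply/seteqP; split => x // [/= _ h]; have := even_half_itv (dbl x); lra.
- move=> a' b' b1; rewrite G11//; congr (_ - _ * _).
  by rewrite !clampE; do ![case: ltP => ?]; lra.
- have -> : clamp (1 : R) = 1 by rewrite clampE ltxx; case: ltP => //; lra.
  apply/eqP; rewrite subr_eq0 mulr1; apply/eqP; apply: EFin_inj.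
  rewrite -QE (_ : E _ _ = setT) ?probability_setT//.
  apply/seteqP; split => x // _; split => /=.
    by have := even_half_itv x; lra.
  by have := even_half_itv (dbl x); lra.
Qed.

(** Rays are replaced by Borel sets one coordinate at a time: with the other set fixed, both sides
    are finite measures in the free one. This is [key], applied twice. *)
Lemma split_indep (A B : set R) : measurable A -> measurable B ->
  Q (even_half @^-1` A `&` (even_half \o dbl) @^-1` B) = (Q A * Q B)%E.
Proof.
have Qle1 C : measurable C -> (Q C < +oo)%E.
  by move=> mC; rewrite (le_lt_trans (probability_le1 _ mC)) ?ltry.
have Qge0 C : 0 <= fine (Q C) by rewrite fine_ge0.
have mpre (f : R -> R) C : measurable_fun setT f -> measurable C -> measurable (f @^-1` C).
  by move=> mf mC; rewrite -[X in measurable X]setTI; exact: mf.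
have key (f g : R -> R) (mf : measurable_fun setT f) (mg : measurable_fun setT g) B' :
  measurable B' ->
  (forall a, Q (f @^-1` `]-oo, a]%classic `&` g @^-1` B') = ((clamp a)%:E * Q B')%E) ->
  forall A', measurable A' -> Q (f @^-1` A' `&` g @^-1` B') = (Q A' * Q B')%E.
  move=> mB' H A' mA'.
  have [m1 m1E] : exists m1 : {measure set R -> \bar R},
      forall C, m1 C = Q (f @^-1` C `&` g @^-1` B').
    by exists (measure_function_pushforward__canonical__measure_function_Measure
      (mrestr Q (mpre _ _ mg mB')) mf).
  have [m2 m2E] : exists m2 : {measure set R -> \bar R},
      forall C, m2 C = (Q C * Q B')%E.
    exists (mscale (NngNum (Qge0 B')) Q) => C.
    transitivity ((fine (Q B'))%:E * Q C)%E => //.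
    by rewrite fineK ?fin_num_measure// muleC.
  rewrite -m1E -m2E; apply: measure_unique_ray => // a.
    by rewrite m1E m2E H Q_ray.
  rewrite m1E; apply: Qle1; apply: measurableI; exact: mpre.
move=> mA mB; apply: (key) => // a.
have meas_ray b : measurable (`]-oo, b]%classic : set R) by exact: measurable_itv.
rewrite setIC muleC -Q_ray; apply: (key) => // b.
rewrite Q_ray -EFinM mulrC -G_joint; congr (Q _).
by rewrite setIC; apply/seteqP; split => x [/=]; rewrite !in_itv.
Qed.

End splitting_law.

(** * An i.i.d. sequence of uniform variables *)

Section iid.
Context {R : realType}.
Variable Q : probability R R.
Hypothesis Q_ray : forall a, Q `]-oo, a]%classic = (clamp a)%:E.

Let v : R -> R := even_half \o dbl.

Let mu := @measurable_even_half R.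

Let mv : measurable_fun setT v.
Proof. by apply: measurableT_comp => //; exact: measurable_dbl. Qed.

Lemma even_half_law (A : set R) : measurable A -> Q (even_half @^-1` A) = Q A.
Proof.
move=> mA; have := split_indep Q_ray mA (@measurableT _ _).
by rewrite preimage_setT setIT probability_setT mule1.
Qed.

Let v_law (A : set R) : measurable A -> Q (v @^-1` A) = Q A.
Proof.
move=> mA; have := split_indep Q_ray (@measurableT _ _) mA.
by rewrite preimage_setT setTI probability_setT mul1e.
Qed.

(** Each [v] keeps only the digits in odd places, and [even_half] then reads every second one of
    those left; one expansion is thus cut into infinitely many disjoint ones. *)
Definition even_seq (i : nat) (x : R) : R := even_half (iter i v x).

Lemma measurable_even_seq i : measurable_fun setT (even_seq i).
Proof.
apply: measurableT_comp => //; elim: i => [|i IH]; first exact: measurable_id.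
exact: (measurableT_comp mv IH).
Qed.

Lemma even_seq_law i (A : set R) : measurable A -> Q (even_seq i @^-1` A) = Q A.
Proof.
elim: i A => [|i IH] A mA; first exact: even_half_law.
rewrite -(IH A mA) -(v_law (preimage_measurable (measurable_even_seq i) mA)).
by congr (Q _); apply/seteqP; split => x /=; rewrite /even_seq iterSr.
Qed.

(** The first term reads the even places, while all later terms are functions of [v x];
    [split_indep] separates them, and induction does the rest. *)
Lemma even_seq_indep n (A : nat -> set R) : (forall i, measurable (A i)) ->
  Q [set x | forall i, (i < n)%N -> A i (even_seq i x)] = (\prod_(i < n) Q (A i))%E.
Proof.
elim: n A => [|n IH] A mA.
  by rewrite big_ord0 -(probability_setT Q); congr (Q _); apply/seteqP; split.
rewrite big_ord_recl/= -(IH (fun i => A i.+1))// -split_indep//; last first.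
  rewrite (_ : mkset _ = \bigcap_(i in `I_n) (even_seq i @^-1` A i.+1)).
    by apply: bigcap_measurableType => i _; exact: preimage_measurable (measurable_even_seq i) _.
  by apply/seteqP; split => x /=.
congr (Q _); apply/seteqP; split => x /=.
  move=> h; split; first exact: (h 0%N).
  by move=> i iltn; have := h i.+1 iltn; rewrite /even_seq iterSr.
move=> [h0 h] [|i] iltn; first exact: h0.
by have := h i iltn; rewrite /even_seq iterSr.
Qed.

End iid.

(** * The quantile transform *)

Section quantile.
Context {R : realType}.
Variable Q : probability R R.
Hypothesis Q_ray : forall a, Q `]-oo, a]%classic = (clamp a)%:E.
Variable nu : probability R R.
Hypothesis nu01 : prob01 nu.

Let F (a : R) := fine (nu `]-oo, a]%classic).
Let S (t : R) := [set x | 0 <= x <= 1 /\ t <= F x].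
Let q (t : R) := inf (S t).

Let nuF a : nu `]-oo, a]%classic = (F a)%:E.
Proof. by rewrite /F fineK// fin_num_measure. Qed.

Let F_itv a : 0 <= F a <= 1.
Proof. by rewrite -!lee_fin -nuF measure_ge0 probability_le1. Qed.

Let F_nd a b : a <= b -> F a <= F b.
Proof.
move=> ab; rewrite -lee_fin -!nuF; apply: le_measure; rewrite ?inE//.
by apply: subset_itvl; rewrite bnd_simp.
Qed.

Let nu_out (A : set R) : measurable A -> A `&` `[0, 1]%classic = set0 -> nu A = 0%E.
Proof.
move=> mA A01; apply/eqP; rewrite eq_le measure_ge0 andbT.
apply: (@le_trans _ _ (nu (~` `[0, 1]%classic))).
  apply: le_measure; rewrite ?inE//; first exact: measurableC.
  by move=> x Ax xI; rewrite -[False]/(set0 x) -A01.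
by rewrite probability_setC// nu01 subee.
Qed.

Let F_lt0 a : a < 0 -> F a = 0.
Proof.
move=> a0; rewrite /F nu_out//.
by apply/seteqP; split => x //= []; rewrite !in_itv/=; lra.
Qed.

Let F_ge1 a : 1 <= a -> F a = 1.
Proof.
move=> a1; apply/eqP; rewrite eq_le (andP (F_itv a)).2/=.
rewrite -lee_fin -nuF -nu01; apply: le_measure; rewrite ?inE//.
by move=> x /=; rewrite !in_itv/=; lra.
Qed.

(** Right-continuity of the distribution function, by continuity from above along [a + 1/(n+1)]; it
    puts the infimum [q t] on the correct side of [t <= F a]. *)
Let F_rc a t : (forall x, a < x -> t <= F x) -> t <= F a.
Proof.
move=> h.
have cv : nu `]-oo, (a + n.+1%:R^-1)]%classic @[n --> \oo] --> nu `]-oo, a]%classic.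
  have -> : `]-oo, a]%classic = \bigcap_n `]-oo, (a + n.+1%:R^-1)]%classic :> set R.
    apply/seteqP; split => x /=.
      rewrite in_itv/= => xa n _ /=; rewrite in_itv/=.
      by rewrite (le_trans xa)// lerDl invr_ge0.
    move=> h'; rewrite in_itv/=; apply/ler_addgt0Pr => e e0.
    have [n ne] : exists n, n.+1%:R^-1 < e.
      exists (Num.truncn e^-1); rewrite invf_plt ?posrE//; exact: truncnS_gt.
    by have := h' n I; rewrite /= in_itv/= => /le_trans; apply; rewrite lerD2l ltW.
  apply: (@nonincreasing_cvg_mu _ _ _ nu (fun n => `]-oo, (a + n.+1%:R^-1)]%classic)) => //.
  - by rewrite (le_lt_trans (probability_le1 _ _))// ltry.
  - exact: bigcap_measurable.
  - move=> m n mn; apply/subsetPset; apply: subset_itvl; rewrite bnd_simp lerD2l.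
    by rewrite lef_pV2 ?posrE// ler_nat.
rewrite -lee_fin -nuF -(cvg_lim _ cv)//; apply: lime_ge; first exact: (cvgP _ cv).
by near=> n; rewrite nuF lee_fin; apply: h; rewrite ltrDl invr_gt0.
Unshelve. all: by end_near. Qed.

(** The Galois connection between quantile and distribution function. For [t > 1] the set [S t] is
    empty and its [inf] is 0, whence the second alternative. *)
Let q_ray a t : q t <= a <-> 0 <= a /\ (t <= F a \/ 1 < t).
Proof.
have S_lb : has_lbound (S t) by exists 0 => x [/andP[]].
have q0 : 0 <= q t.
  have [E|/set0P S0] := eqVneq (S t) set0; first by rewrite /q E inf0.
  by apply: lb_le_inf => // x [/andP[]].
have [t1|t1] := ltP 1 t.
  have S0 : S t = set0.
    by apply/seteqP; split => x // [_]; have := F_itv x; lra.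
  by rewrite /q S0 inf0; split => [->|[]//]; split => //; right.
have S1 : S t 1 by split; [lra|rewrite F_ge1].
split=> [qa|[a0 [ta|]]]; last 2 first.
- have [a1|a1] := leP a 1; first by apply: ge_inf => //; split=> //; lra.
  by apply: (@le_trans _ _ 1); [exact: ge_inf|exact: ltW].
- lra.
split; first exact: le_trans qa.
left; apply: F_rc => x ax.
have [s [_ sF] sx] : exists2 s, S t s & s < x.
  by apply: inf_lt; [exists 1|exact: le_lt_trans ax].
by apply: (le_trans sF); apply: F_nd; exact: ltW.
Qed.

Let q_itv t : 0 <= q t <= 1.
Proof.
have := (q_ray (q t) t).1 (lexx _) => -[-> _] /=.
apply/q_ray; split => //; rewrite F_ge1//.
by case: (leP t 1); [left|right].
Qed.

Let q_preimage a : q @^-1` `]-oo, a] =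
  if 0 <= a then `]-oo, F a]%classic `|` `]1, +oo[%classic else set0.
Proof.
apply/seteqP; split => t /=; rewrite in_itv/=.
  by move=> /q_ray[-> h] /=; rewrite !in_itv/= andbT; case: h; [left|right].
case: ifP => // a0; rewrite /= !in_itv/= andbT => h.
by apply/q_ray; split.
Qed.

Let mq : measurable_fun setT q.
Proof.
move=> mT; apply: (measurability _ (RGenOInfty.measurableE R)) => //.
move=> _ [_ [a ->] <-].
have h : measurable (q @^-1` `]-oo, a]%classic).
  by rewrite q_preimage; case: ifP => _ //; exact: measurableU.
by rewrite setTI -setCitvl; exact: measurableC h.
Qed.

(** For [a >= 0] the preimage of the ray ending at [a] is, up to the null set ]1, +oo[, the ray
    ending at [F a], of mass [F a]; for [a < 0] both sides vanish. *)
Lemma quantile_ex : exists q : R -> R, [/\ measurable_fun setT q,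
  forall t, 0 <= q t <= 1 & forall A, measurable A -> Q (q @^-1` A) = nu A].
Proof.
exists q; split => //.
pose qQ : {RV Q >-> R} := HB.pack q (isMeasurableFun.Build _ _ _ _ _ mq).
move=> A mA; rewrite -[LHS]/(distribution Q qQ A).
apply: measure_unique_ray => // a; last first.
  by rewrite (le_lt_trans (probability_le1 _ _))// ltry.
rewrite -[LHS]/(Q (q @^-1` `]-oo, a]%classic)) q_preimage.
transitivity (F a)%:E; last by rewrite -nuF.
case: ifPn => [a0|]; last by rewrite -ltNge => /F_lt0 ->; rewrite measure0.
rewrite [RHS](_ : _ = (clamp (F a))%:E); last first.
  congr EFin; rewrite clampE; have := F_itv a; do ![case: ltP => ?]; lra.
rewrite -Q_ray; apply: (uniform_eq Q_ray) => //; first by apply: measurableU; exact: measurable_itv.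
move=> x x01; rewrite /= !in_itv/= andbT; split => [[//|]|]; last by left.
by lra.
Qed.

End quantile.

(** * Products with a random, possibly infinite, number of factors *)

Section eprod.
Context {R : realType}.

Definition enat_gt (i : nat) (k : enat) : bool := if k is Some n then (i < n)%N else true.

Lemma prod_itv01 (x : nat -> R) n : (forall i, 0 <= x i <= 1) -> 0 <= \prod_(i < n) x i <= 1.
Proof.
move=> x01; apply/andP; split; first by apply: prodr_ge0 => i _; have /andP[] := x01 i.
by apply: prodr_ile1 => i _; exact: x01.
Qed.

Lemma prod_cvg (x : nat -> R) : (forall i, 0 <= x i <= 1) ->
  (\prod_(i < n) x i) @[n --> \oo] --> limn (fun n => \prod_(i < n) x i).
Proof.
move=> x01; apply: nonincreasing_is_cvgn; last first.
  by exists 0 => _ [n _ <-]; have /andP[] := @prod_itv01 _ n x01.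
apply/nonincreasing_seqP => n; rewrite big_ord_recr/= ler_piMr//.
  by have /andP[] := @prod_itv01 _ n x01.
by have /andP[] := x01 n.
Qed.

(** Padding with ones beyond [k] presents the finite and the infinite product alike as limits of
    finite products; bounds, measurability and squares then pass to the limit. *)
Lemma eprod_cvg (k : enat) (x : nat -> R) : (forall i, 0 <= x i <= 1) ->
  (\prod_(i < n) (if enat_gt i k then x i else 1)) @[n --> \oo] --> eprod k x.
Proof.
case: k => [m|] x01 /=; last exact: prod_cvg.
apply: cvg_near_cst; near=> n.
have mn : (m <= n)%N by near: n; exists m.
by rewrite (big_ord_widen n (fun i => x i))// [RHS]big_mkcond.
Unshelve. all: by end_near. Qed.

Lemma eprod_itv01 (k : enat) (x : nat -> R) : (forall i, 0 <= x i <= 1) ->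
  0 <= eprod k x <= 1.
Proof.
move=> x01; have cv := @eprod_cvg k _ x01.
have h n : 0 <= \prod_(i < n) (if enat_gt i k then x i else 1) <= 1.
  by apply: (@prod_itv01 (fun i => if enat_gt i k then x i else 1)) => i; case: ifP; rewrite ?lexx ?ler01.
rewrite -(cvg_lim _ cv)//; apply/andP; split.
  by apply: limr_ge; [exact: cvgP cv|near=> n; have /andP[] := h n].
by apply: limr_le; [exact: cvgP cv|near=> n; have /andP[] := h n].
Unshelve. all: by end_near. Qed.

Lemma measurable_eprod d (T : measurableType d) (N : T -> enat) (X : nat -> T -> R) :
  measurable_fun setT N -> (forall i, measurable_fun setT (X i)) ->
  (forall i w, 0 <= X i w <= 1) ->
  measurable_fun setT (fun w => eprod (N w) (X ^~ w)).
Proof.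
move=> mN mX X01.
apply: (measurable_fun_cvg
  (h := fun n w => \prod_(i < n) (if enat_gt i (N w) then X i w else 1))).
  move=> n; apply: measurable_prod => i _.
  apply: measurable_fun_ifT => //.
  by apply: (measurableT_comp (f := enat_gt i)).
by move=> w _; apply: eprod_cvg.
Qed.

End eprod.

(** The pullback by [f] of the measurable sets is a sigma-algebra containing the generators. With
    [f] a projection, it turns generated events into cylinders of a product space. *)
Lemma sigma_gen_preimage d d' d'' (T : measurableType d) (S : measurableType d')
    (T' : measurableType d'') (I : Type) (D : set I) (X : I -> T -> T')
    (f : T -> S) (Y : I -> S -> T') :
  (forall i, measurable_fun setT (Y i)) -> (forall i, X i = Y i \o f) ->
  forall F, <<s sigma_gen D X >> F -> exists2 B, measurable B & F = f @^-1` B.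
Proof.
move=> mY XE F sF.
have : preimage_set_system setT f measurable F.
  apply: sF; split; first exact/sigma_algebra_preimage/sigma_algebra_measurable.
  move=> _ [i _ [B mB <-]]; exists (Y i @^-1` B); first by rewrite -[X in measurable X]setTI; exact: mY.
  by rewrite XE comp_preimage.
by move=> [B mB <-]; exists B => //; rewrite setTI.
Qed.

(** * Existence of the image law *)

Section existence.
Context {R : realType} (p : probability enat R) (nu : probability R R).
Hypothesis nu01 : prob01 nu.

(** On the product of [p] with the uniform law, the first coordinate serves as N, and the quantiles
    of the independent uniform variables [even_seq i] serve as the factors. *)
Lemma RDE_image_ex : exists nu', RDE_image p nu nu'.
Proof.
have Q_ray := @unif_ray R; set Q := unif R in Q_ray.
have [q [mq q01 q_law]] := quantile_ex Q_ray nu01.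
pose X' i := q \o even_seq i.
have mX' i : measurable_fun setT (X' i).
  by apply: measurableT_comp => //; exact: measurable_even_seq.
have X'_law i A : measurable A -> Q (X' i @^-1` A) = nu A.
  move=> mA; rewrite /X' comp_preimage (even_seq_law Q_ray) ?q_law//.
  exact: preimage_measurable.
pose P : probability (enat * R)%type R := (p \x Q)%E.
have P_fst A : P (fst @^-1` A) = p A.
  have -> : fst @^-1` A = A `*` setT :> set (enat * R) by apply/seteqP; split => x //= [].
  by rewrite -[LHS]/((p \x Q)%E _) product_measure1E// -[RHS]mule1 -(probability_setT Q).
have P_snd B : measurable B -> P (snd @^-1` B) = Q B.
  move=> mB; have -> : snd @^-1` B = setT `*` B :> set (enat * R).
    by apply/seteqP; split => x //= [].
  by rewrite -[LHS]/((p \x Q)%E _) product_measure1E// -[RHS]mul1e -(probability_setT p).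
pose N : {RV P >-> enat} := HB.pack (@fst enat R)
  (isMeasurableFun.Build _ _ _ _ _ (@measurable_fst _ _ enat R)).
have mX i : measurable_fun setT (X' i \o @snd enat R).
  exact: measurableT_comp (mX' i) measurable_snd.
pose X i : {RV P >-> R} := HB.pack (X' i \o @snd enat R)
  (isMeasurableFun.Build _ _ _ _ _ (mX i)).
have X01 i w : 0 <= X i w <= 1 by exact: q01.
have mY : measurable_fun setT (fun w => 1 - eprod (N w) (fun i => X i w)).
  by apply: measurable_funB => //; apply: measurable_eprod.
pose Y : {RV P >-> R} := HB.pack (fun w => 1 - eprod (N w) (fun i => X i w))
  (isMeasurableFun.Build _ _ _ _ _ mY).
exists (distribution P Y), _, (enat * R)%type, P, N, X; split => //.
- move=> i; split=> // A mA; rewrite /= comp_preimage P_snd ?X'_law//.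
  exact: preimage_measurable.
- move=> s A us _ mA.
  (* The index set [s] lies below [n]; imposing the full set at the missing indices gives an event
     on an initial segment, as [even_seq_indep] requires. *)
  pose n := (\max_(i <- s) i).+1.
  have sn i : i \in s -> (i < n)%N by move=> si; rewrite ltnS; exact: leq_bigmax_seq.
  pose B i := if i \in s then q @^-1` A i else setT.
  have mB i : measurable (B i) by rewrite /B; case: ifP => // _; exact: preimage_measurable.
  have -> : \bigcap_(i in [set` s]) X i @^-1` A i =
      snd @^-1` [set x | forall i, (i < n)%N -> B i (even_seq i x)].
    apply/seteqP; split => w /=.
      by move=> h i _; rewrite /B; case: ifP => // si; exact: h.
    by move=> h i /= si; have := h i (sn _ si); rewrite /B si.
  rewrite P_snd; last first.
    rewrite (_ : mkset _ = \bigcap_(i in `I_n) (even_seq i @^-1` B i)); last first.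
      by apply/seteqP; split.
    by apply: bigcap_measurableType => i _; exact: preimage_measurable (measurable_even_seq i) _.
  rewrite even_seq_indep//.
  rewrite (eq_bigr (fun i : 'I_n => if (i : nat) \in s then nu (A i) else 1%E)); last first.
    by move=> i _; rewrite /B; case: ifP => _; rewrite ?q_law// probability_setT.
  rewrite -big_mkcond/= -(big_mkord (fun i => i \in s) (fun i => nu (A i))).
  rewrite -big_filter; under [RHS]eq_bigr => i _.
    rewrite /= comp_preimage P_snd ?X'_law//; last exact: preimage_measurable.
    over.
  apply: perm_big; apply: uniq_perm => //; first by rewrite filter_uniq// iota_uniq.
  by move=> i; rewrite mem_filter mem_index_iota /=; case: (boolP (i \in s)) => // /sn.
- move=> F G sF sG.
  have [F' mF' ->] := sigma_gen_preimage (f := snd) mX' (fun=> erefl) sF.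
  have [G' mG' ->] := @sigma_gen_preimage _ _ _ _ enat enat unit setT
    (fun=> N) fst (fun=> id) (fun=> @measurable_id _ _ setT) (fun=> erefl) _ sG.
  rewrite P_snd// P_fst muleC -[RHS]product_measure1E// setIC.
  by rewrite (_ : _ `&` _ = G' `*` F')//; apply/seteqP; split => x [].
Qed.

End existence.

(** * Moments of an image law *)

Section indep_product.
Context d (T : measurableType d) (R : realType) (P : probability T R).
Local Open Scope ereal_scope.

Lemma measurable_le_set (f g : T -> R) : measurable_fun setT f -> measurable_fun setT g ->
  measurable [set w | (f w <= g w)%R].
Proof.
move=> mf mg; rewrite (_ : mkset _ = (fun w => (f w <= g w)%R) @^-1` [set true]); last first.
  by apply/seteqP; split => w /=.
by rewrite -[X in measurable X]setTI; apply: measurable_fun_ler.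
Qed.

(* Layer cake: X(w) is the mass of ]-oo, X(w)] under the uniform law, and
   Tonelli exchanges the two integrals. *)
Lemma expectation_indep_mul (X Z : T -> R) :
  measurable_fun setT X -> measurable_fun setT Z ->
  (forall w, (0 <= X w <= 1)%R) -> (forall w, (0 <= Z w)%R) ->
  (forall a : R, \int[P]_(w in [set w | (a <= X w)%R]) (Z w)%:E =
     P [set w | (a <= X w)%R] * \int[P]_w (Z w)%:E) ->
  \int[P]_w (X w * Z w)%:E = (\int[P]_w (X w)%:E) * \int[P]_w (Z w)%:E.
Proof.
move=> mX mZ X01 Z0 H.
have [Q Q_ray] : exists Q : probability R R,
    forall a, Q `]-oo, a]%classic = (clamp a)%:E.
  by exists (unif R) => a; exact: unif_ray.
have mle : forall a : R, measurable [set w | (a <= X w)%R].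
  by move=> a; exact: measurable_le_set.
have layer (f : T -> R) : measurable_fun setT f -> (forall w, (0 <= f w)%R) ->
    \int[P]_w (X w * f w)%:E = \int[Q]_t \int[P]_(w in [set w | (t <= X w)%R]) (f w)%:E.
  move=> mf f0.
  pose F (wt : T * R) := (if (wt.2 <= X wt.1)%R then f wt.1 else 0%R)%:E.
  have mF : measurable_fun setT F.
    apply/measurable_EFinP; apply: measurable_fun_ifT => //.
      apply: measurable_fun_ler => //; exact: measurableT_comp.
    exact: measurableT_comp.
  have F0 wt : 0 <= F wt by rewrite lee_fin; case: ifP.
  transitivity (\int[P]_w \int[Q]_t F (w, t)).
    apply: eq_integral => w _.
    transitivity (\int[Q]_(t in `]-oo, (X w)]%classic) (f w)%:E).
      rewrite integral_cst//= Q_ray -EFinM mulrC clampE.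
      by congr (_ * _)%:E; have := X01 w; do ![case: ltP => ?]; lra.
    rewrite [LHS]integral_mkcond; apply: eq_integral => t _.
    by rewrite /F /patch/= mem_setE in_itv/=; case: ifP.
  rewrite fubini_tonelli//; apply: eq_integral => t _.
  rewrite [RHS]integral_mkcond; apply: eq_integral => w _.
  rewrite /F patchE/=; case: ifPn => h; first by rewrite mem_set.
  by rewrite memNset//; exact/negP.
rewrite layer//; under eq_integral => t _ do rewrite H.
rewrite ge0_integralZr//; last 2 first.
- rewrite (_ : (fun _ => _) = EFin \o (fun t => fine (P [set w | (t <= X w)%R]))); last first.
    by apply/funext => t /=; rewrite fineK// fin_num_measure.
  apply/measurable_EFinP; apply: nonincreasing_measurable => //= s t st.
  rewrite fine_le ?fin_num_measure//; apply: le_measure; rewrite ?inE//.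
  by move=> w; exact: le_trans.
- by apply: integral_ge0 => w _; rewrite lee_fin.
congr (_ * _).
(* The layer formula for the constant 1 identifies the remaining factor as the mean of [X]. *)
transitivity (\int[P]_w (X w * 1)%:E); last by apply: eq_integral => w _; rewrite mulr1.
rewrite layer//; apply: eq_integral => t _.
by rewrite integral_cst// mul1e.
Qed.

(** Induction on [n], with [X n] as one factor and the indicator of [B] times the earlier variables
    as the other. The event [B] is general so that it can absorb the constraint [a <= X n]. *)
Lemma expectation_indep_prod (X : nat -> T -> R) n (B : set T) :
  (forall i, measurable_fun setT (X i)) -> (forall i w, (0 <= X i w <= 1)%R) ->
  measurable B ->
  (forall A : nat -> set R, (forall i, measurable (A i)) ->
     P (B `&` [set w | forall i, (i < n)%N -> A i (X i w)]) =
     P B * \prod_(i < n) P (X i @^-1` A i)) ->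
  \int[P]_(w in B) (\prod_(i < n) X i w)%:E = P B * \prod_(i < n) \int[P]_w (X i w)%:E.
Proof.
move=> mX X01; elim: n B => [|n IH] B mB H.
  under eq_integral => w _ do rewrite big_ord0.
  by rewrite integral_cst// big_ord0 mul1e mule1.
pose Z w := (\1_B w * \prod_(i < n) X i w)%R.
have mprod : measurable_fun setT (fun w => \prod_(i < n) X i w)%R.
  by apply: measurable_prod.
have mZ : measurable_fun setT Z by apply: measurable_funM.
have Z0 w : (0 <= Z w)%R by rewrite mulr_ge0//; apply: prodr_ge0 => i _; have /andP[] := X01 i w.
have ZB (C : set T) : \int[P]_(w in C) (Z w)%:E =
    \int[P]_(w in C `&` B) (\prod_(i < n) X i w)%:E.
  rewrite integral_mkcondr; apply: eq_integral => w _.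
  by rewrite /Z /patch indicE; case: ifP => _; rewrite ?mul1r ?mul0r.
have PT : P [set: T] = 1 by exact: probability_setT.
have HB A : (forall i, measurable (A i)) ->
    P (B `&` [set w | forall i, (i < n)%N -> A i (X i w)]) =
     P B * \prod_(i < n) P (X i @^-1` A i).
  move=> mA; have := H (fun i => if (i < n)%N then A i else setT).
  rewrite big_ord_recr/= ltnn [X in _ * (_ * X)](_ : _ = 1) ?mule1; last first.
    exact: PT.
  under eq_bigr => i _ do rewrite ltn_ord.
  move=> <-; last by move=> i; case: ifP.
  congr (P (_ `&` _)); apply/seteqP; split => w /= h i; last first.
    by move=> ltin; have := h i (ltnW ltin); rewrite ltin.
  by move=> _; case: ifP => // /h.
have mle a : measurable [set w | (a <= X n w)%R] by exact: measurable_le_set.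
have PBa a : P (B `&` [set w | (a <= X n w)%R]) = P B * P [set w | (a <= X n w)%R].
  have := H (fun i => if i == n then `[a, +oo[%classic else setT).
  rewrite big_ord_recr/= eqxx big1; last first.
    by move=> i _; rewrite (ltn_eqF (ltn_ord i)); exact: PT.
  rewrite mul1e => h; transitivity (P B * P (X n @^-1` `[a, +oo[)); last first.
    by congr (_ * P _); apply/seteqP; split => w /=; rewrite in_itv/= andbT.
  rewrite -h; last by move=> i; case: ifP.
  congr (P (_ `&` _)); apply/seteqP; split => w /=.
    by move=> aw i _; case: ifP => // /eqP ->; rewrite /= in_itv/= andbT.
  by move=> /(_ n (leqnn _)); rewrite eqxx/= in_itv/= andbT.
transitivity (\int[P]_w (X n w * Z w)%:E).
  rewrite integral_mkcond; apply: eq_integral => w _.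
  rewrite /Z /patch indicE big_ord_recr/=; case: ifP => _; last by rewrite mul0r mulr0.
  by rewrite mul1r mulrC.
(* The condition on upper level sets of [X n] uses the induction hypothesis twice: for [B], and for
   [B] cut by [a <= X n]. *)
rewrite expectation_indep_mul//; last first.
  move=> a; rewrite !ZB setTI (IH B mB HB).
  rewrite setIC (IH (B `&` _)); last 2 first.
  - exact: measurableI.
  - move=> A mA; rewrite -setIA.
    have := H (fun i => if i == n then `[a, +oo[%classic else A i).
    rewrite big_ord_recr/= eqxx.
    under eq_bigr => i _ do rewrite (ltn_eqF (ltn_ord i)).
    rewrite PBa.
    have -> : X n @^-1` `[a, +oo[ = [set w | (a <= X n w)%R].
      by apply/seteqP; split => w /=; rewrite in_itv/= andbT.
    rewrite [X in _ * X]muleC muleA => <-; last by move=> i; case: ifP.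
    congr (P (_ `&` _)); apply/seteqP; split => w /=.
      move=> [aw h] i; rewrite ltnS leq_eqVlt => /predU1P[->|ltin].
        by rewrite eqxx/= in_itv/= andbT.
      by rewrite (ltn_eqF ltin); exact: h.
    move=> h; split; first by have := h n (leqnn _); rewrite eqxx/= in_itv/= andbT.
    by move=> i ltin; have := h i (ltnW ltin); rewrite (ltn_eqF ltin).
  by rewrite PBa muleAC muleC muleA.
rewrite ZB setTI (IH B mB HB) big_ord_recr/=.
by rewrite muleC muleA.
Qed.

End indep_product.

(** Enumerates the values of N with infinity in place 0, so that integrals over N become series. *)
Definition enat_of (i : nat) : enat := if i is j.+1 then Some j else None.

(** * The generating function as the mean of a random product *)

Section generating_function.
Context {R : realType} (p : probability enat R).
Local Open Scope ereal_scope.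

Lemma integral_enat d (T : measurableType d) (P : {measure set T -> \bar R})
    (N : T -> enat) (f : T -> \bar R) :
  measurable_fun setT N -> measurable_fun setT f -> (forall w, 0 <= f w) ->
  \int[P]_w f w = \sum_(i <oo) \int[P]_(w in N @^-1` [set enat_of i]) f w.
Proof.
move=> mN mf f0.
have E : \bigcup_i (N @^-1` [set enat_of i]) = setT.
  apply/seteqP; split => // w _ /=.
  by case NE : (N w) => [k|]; [exists k.+1|exists 0%N].
rewrite -[X in \int[P]_(w in X) _]E ge0_integral_bigcup ?E//.
- by move=> i; exact: preimage_measurable.
- move=> i j _ _ [w [/= -> ]]; by case: i j => [|i] [|j] //= [->].
Qed.

Lemma epow_itv01 (s : R) k : (0 <= s <= 1)%R -> (0 <= epow s k <= 1)%R.
Proof.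
move=> /andP[s0 s1]; case: k => [k|] /=; last by case: ifP; rewrite lexx ler01.
by rewrite exprn_ge0//= exprn_ile1.
Qed.

Lemma genfun_integral (s : R) : (0 <= s <= 1)%R ->
  (genfun p s)%:E = \int[p]_k (epow s k)%:E.
Proof.
move=> s01; rewrite /genfun unlock fineK// ge0_fin_numE; last first.
  by apply: integral_ge0 => k _; have /andP[] := epow_itv01 k s01.
apply: (@le_lt_trans _ _ (\int[p]_k 1)); last by rewrite integral_cst//= mul1e probability_setT ltry.
apply: ge0_le_integral => //.
- by move=> k _; have /andP[] := epow_itv01 k s01.
- by move=> k _; rewrite lee_fin; have /andP[] := epow_itv01 k s01.
Qed.

Lemma genfun_sum (s : R) : (0 <= s <= 1)%R ->
  (genfun p s)%:E = \sum_(i <oo) ((epow s (enat_of i))%:E * p [set enat_of i]).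
Proof.
move=> s01; rewrite genfun_integral//.
rewrite (@integral_enat _ enat p idfun)//; last first.
  by move=> k; have /andP[] := epow_itv01 k s01.
apply: eq_eseriesr => i _; rewrite preimage_id.
rewrite (eq_integral (fun=> (epow s (enat_of i))%:E)).
  by rewrite integral_cst.
by move=> k; rewrite inE => ->.
Qed.

Lemma genfun1 : genfun p 1 = 1%R.
Proof.
apply: EFin_inj; rewrite genfun_integral ?lexx ?ler01//.
rewrite (eq_integral (fun=> 1)); first by rewrite integral_cst//= mul1e probability_setT.
by move=> [k|] _ /=; rewrite ?expr1n ?eqxx.
Qed.

Lemma genfun_nd (s t : R) : (0 <= s)%R -> (s <= t)%R -> (t <= 1)%R ->
  (genfun p s <= genfun p t)%R.
Proof.
move=> s0 st t1.
have s01 : (0 <= s <= 1)%R by rewrite s0 (le_trans st).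
have t01 : (0 <= t <= 1)%R by rewrite t1 (le_trans s0).
rewrite -lee_fin !genfun_integral//; apply: ge0_le_integral => //.
- by move=> k _; have /andP[] := epow_itv01 k s01.
- move=> [k|] _; rewrite lee_fin /=; first by apply: lerXn2r; rewrite ?nnegrE//; case/andP: t01.
  have [s1|] := eqVneq s 1%R; last by case: ifP.
  by rewrite (_ : t == 1%R)// eq_le t1 -s1.
Qed.

(** The space is split along the values of N. On a finite value [k], independence turns the product
    into [s ^+ k]; the resulting series is that of [genfun_sum]. *)
Lemma eprod_mean d (T : measurableType d) (P : probability T R) (N : T -> enat)
    (X : nat -> T -> R) (s : R) :
  measurable_fun setT N -> (forall i, measurable_fun setT (X i)) ->
  (forall i w, (0 <= X i w <= 1)%R) ->
  (forall k n (A : nat -> set R), (forall i, measurable (A i)) ->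
     P (N @^-1` [set k] `&` [set w | forall i, (i < n)%N -> A i (X i w)]) =
     p [set k] * \prod_(i < n) P (X i @^-1` A i)) ->
  (forall i, \int[P]_w (X i w)%:E = s%:E) -> (0 <= s <= 1)%R ->
  \int[P]_w (eprod (N w) (X ^~ w))%:E = (genfun p s)%:E.
Proof.
move=> mN mX X01 H Xs s01.
have mNk k : measurable (N @^-1` [set k]) by exact: preimage_measurable.
have PN k : P (N @^-1` [set k]) = p [set k].
  have := H k 0%N (fun=> setT); rewrite big_ord0 mule1 => <- //.
  by congr (P _); apply/seteqP; split => w //= [].
have fin k n : \int[P]_(w in N @^-1` [set k]) (\prod_(i < n) X i w)%:E =
    p [set k] * (s ^+ n)%:E.
  rewrite expectation_indep_prod//; last first.
    by move=> A mA; rewrite H// PN.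
  rewrite PN; congr (_ * _); under eq_bigr => i _ do rewrite Xs.
  by rewrite prodEFin big_const_ord iter_mulr_1.
rewrite (@integral_enat _ _ P N)//; last 2 first.
- by apply/measurable_EFinP; exact: measurable_eprod.
- by move=> w; rewrite lee_fin; have /andP[] := @eprod_itv01 _ (N w) (X ^~ w) (X01 ^~ w).
rewrite genfun_sum//; apply: eq_eseriesr => i _.
rewrite muleC; case: i => [|k] /=; last first.
  rewrite -fin; apply: eq_integral => w; rewrite inE/= => -> //.
(* On the event that N is infinite, the partial products are dominated by 1, so the integral is the
   limit of those with mean [s ^+ n]. *)
pose D := N @^-1` [set None].
pose h n w := (\prod_(i < n) X i w)%:E.
pose l w := (limn (fun n => (\prod_(i < n) X i w)%R))%:E.
have h01 n w : (0 <= \prod_(i < n) X i w <= 1)%R by exact: (@prod_itv01 _ (X ^~ w)).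
have mh n : measurable_fun D (h n).
  by apply: measurable_funTS; apply/measurable_EFinP; exact: measurable_prod.
have hl w : h ^~ w @ \oo --> l w.
  by apply: cvg_EFin; [near=> n|exact: (@prod_cvg _ (X ^~ w))].
have ml : measurable_fun D l by apply: (emeasurable_fun_cvg h).
have hle w n : D w -> `|h n w| <= cst 1 w.
  by rewrite /h/= => _; have /andP[h0 h1] := h01 n w; rewrite lee_fin ger0_norm.
have [_ _ cv] := @dominated_convergence _ _ _ P D (mNk None) h l (cst 1) mh ml
  (aeW _ (fun w _ => hl w)) (finite_measure_integrable_cst P 1%R (mNk None))
  (aeW _ hle).
transitivity (\int[P]_(w in D) l w).
  by apply: eq_integral => w; rewrite inE/= => ->.
rewrite -(cvg_lim _ cv)//; apply/cvg_lim => //=.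
under eq_fun do rewrite fin.
apply: cvgeM; first by rewrite mule_def_fin ?fin_num_measure//; case: ifP.
  exact: cvg_cst.
apply: cvg_EFin; first by near=> n.
(* The limit of [s ^+ n] is 1 at [s = 1] and 0 below, in accordance with [epow s None]. *)
case: eqVneq => [->|s1]; first by under eq_fun do rewrite expr1n; exact: cvg_cst.
apply: cvg_expr; have /andP[s0 s1'] := s01.
by rewrite ger0_norm// lt_neqAle s1.
Unshelve. all: by end_near. Qed.

End generating_function.

(** * First and second moments *)

Section moments.
Context {R : realType}.
Local Open Scope ereal_scope.

Definition second_moment01 (nu : probability R R) : R :=
  (\int[nu]_(x in `[0%R, 1%R]) x ^+ 2)%R.

Lemma law_integral d (T : measurableType d) (P : probability T R) (Y : T -> R)
    (nu : probability R R) (g : R -> R) :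
  has_law P Y nu -> measurable_fun setT Y -> (forall w, (0 <= Y w <= 1)%R) ->
  measurable_fun setT g -> (forall x, (0 <= x <= 1)%R -> (0 <= g x)%R) ->
  \int[nu]_(x in `[0%R, 1%R]) (g x)%:E = \int[P]_w (g (Y w))%:E.
Proof.
move=> law mY Y01 mg g0.
pose Y' : {RV P >-> R} := HB.pack Y (isMeasurableFun.Build _ _ _ _ _ mY).
rewrite (eq_measure_integral (distribution P Y')); last by move=> A mA _; exact: (esym (law A mA)).
rewrite ge0_integral_pushforward//.
- rewrite (_ : Y' @^-1` _ = setT)//; apply/seteqP; split => w //= _.
  by rewrite in_itv/=.
- by apply/measurable_EFinP; exact: measurable_funTS.
- by move=> y; rewrite inE/= in_itv/= => /g0; rewrite lee_fin.
Qed.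

Lemma integral_itv01_fin d (T : measurableType d) (P : probability T R) (V : T -> R) :
  measurable_fun setT V -> (forall w, (0 <= V w <= 1)%R) ->
  exists2 v : R, \int[P]_w (V w)%:E = v%:E & (0 <= v <= 1)%R.
Proof.
move=> mV V01.
have h0 : 0 <= \int[P]_w (V w)%:E.
  by apply: integral_ge0 => w _; rewrite lee_fin; have /andP[] := V01 w.
have h1 : \int[P]_w (V w)%:E <= 1.
  apply: (@le_trans _ _ (\int[P]_w 1)).
    apply: ge0_le_integral => //.
    - by move=> w _; rewrite lee_fin; have /andP[] := V01 w.
    - exact/measurable_EFinP.
    - by move=> w _; rewrite lee_fin; have /andP[] := V01 w.
  by rewrite integral_cst//= mul1e probability_setT.
have fi : \int[P]_w (V w)%:E \is a fin_num.
  by rewrite ge0_fin_numE// (le_lt_trans h1)// ltry.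
exists (fine (\int[P]_w (V w)%:E)); first by rewrite fineK.
by rewrite -!lee_fin fineK// h0.
Qed.

Lemma law_prob01 d (T : measurableType d) (P : probability T R) (Y : T -> R)
    (nu : probability R R) :
  has_law P Y nu -> (forall w, (0 <= Y w <= 1)%R) -> prob01 nu.
Proof.
move=> law Y01; rewrite /prob01/= -law//.
have -> : Y @^-1` `[0%R, 1%R]%classic = setT.
  by apply/seteqP; split => w //= _; rewrite in_itv/=.
exact: probability_setT.
Qed.

(** Combines the independence of N from the family with the independence inside the family into the
    product formula that [eprod_mean] takes as hypothesis. *)
Lemma RDE_image_factor (p : probability enat R) d (T : measurableType d)
    (Q : probability T R) (N : {RV Q >-> enat}) (X : nat -> {RV Q >-> R}) :
  has_law Q N p -> mutually_independent Q setT (fun i => X i : T -> R) ->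
  sigma_indep Q <<s sigma_gen setT (fun i => X i : T -> R) >>
    <<s sigma_gen setT (fun _ : unit => N : T -> enat) >> ->
  forall k n (A : nat -> set R), (forall i, measurable (A i)) ->
    Q (N @^-1` [set k] `&` [set w | forall i, (i < n)%N -> A i (X i w)]) =
    p [set k] * \prod_(i < n) Q (X i @^-1` A i).
Proof.
move=> lN iX iN k n A mA.
have FE : [set w | forall i, (i < n)%N -> A i (X i w)] =
    \bigcap_(i in [set` iota 0 n]) X i @^-1` A i.
  by apply/seteqP; split => w /= h i; have := h i; rewrite /= mem_iota.
rewrite setIC iN; last 2 first.
- rewrite FE; set S := sigma_gen _ _.
  apply: (@bigcap_measurableType _ (g_sigma_algebraType S)) => i _.
  apply: sub_sigma_algebra; exists i => //; exists (A i) => //; exact: setTI.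
- by apply: sub_sigma_algebra; exists tt => //; exists [set k] => //; exact: setTI.
rewrite lN// muleC; congr (_ * _).
rewrite FE iX ?iota_uniq//.
by rewrite -{1}(subn0 n) -/(index_iota 0 n) big_mkord.
Qed.

(** The square of the product [V] is the product of the squares, again independent with values in
    [0, 1]; so [eprod_mean] gives both moments of [V], hence those of [1 - V]. *)
Lemma RDE_image_moments (p : probability enat R) (nu nu' : probability R R) :
  RDE_image p nu nu' ->
  [/\ prob01 nu', mean01 nu' = (1 - genfun p (mean01 nu))%R &
    second_moment01 nu' = (1 - 2 * genfun p (mean01 nu) + genfun p (second_moment01 nu))%R].
Proof.
move=> [d [T [Q [N [X [lN lX iX iN lY]]]]]].
have X01 i w : (0 <= X i w <= 1)%R by have [_] := lX i.
have X201 i w : (0 <= X i w ^+ 2 <= 1)%R.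
  by have /andP[a b] := X01 i w; rewrite exprn_ge0//= exprn_ile1.
have mX2 i : measurable_fun setT (fun w => X i w ^+ 2)%R.
  by apply: measurable_funX.
have fac := RDE_image_factor lN iX iN.
pose V w := eprod (N w) (fun i => X i w).
have V01 w : (0 <= V w <= 1)%R by exact: (@eprod_itv01 _ (N w) (X ^~ w)).
have mV : measurable_fun setT V by apply: measurable_eprod.
pose Y w := (1 - V w)%R.
have mY : measurable_fun setT Y by apply: measurable_funB.
have Y01 w : (0 <= Y w <= 1)%R by rewrite /Y; have := V01 w; lra.
have mean_X i : \int[Q]_w (X i w)%:E = (mean01 nu)%:E.
  have [v vE v01] := integral_itv01_fin Q (measurable_funPT (X i)) (X01 i).
  rewrite /mean01 /Rintegral (law_integral (lX i).1 _ _ (@measurable_id _ _ setT))//.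
  - by rewrite vE.
  - by move=> x /andP[].
have mean_X2 i : \int[Q]_w (X i w ^+ 2)%:E = (second_moment01 nu)%:E.
  have [v vE v01] := integral_itv01_fin Q (mX2 i) (X201 i).
  rewrite /second_moment01 /Rintegral (@law_integral _ _ _ _ _ (fun x => x ^+ 2)%R (lX i).1)//.
  - by rewrite vE.
  - by move=> x _; exact: sqr_ge0.
have m01 : (0 <= mean01 nu <= 1)%R.
  have [v vE v01] := integral_itv01_fin Q (measurable_funPT (X 0%N)) (X01 0%N).
  by move: vE; rewrite mean_X => -[->].
have r01 : (0 <= second_moment01 nu <= 1)%R.
  have [v vE v01] := integral_itv01_fin Q (mX2 0%N) (X201 0%N).
  by move: vE; rewrite mean_X2 => -[->].
have EV : \int[Q]_w (V w)%:E = (genfun p (mean01 nu))%:E.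
  exact: (eprod_mean _ _ _ fac).
have V2E w : (V w ^+ 2)%R = eprod (N w) (fun i => X i w ^+ 2)%R.
  have h1 := @eprod_cvg _ (N w) (X ^~ w) (X01 ^~ w).
  have h2 := @eprod_cvg _ (N w) (fun i => X i w ^+ 2)%R (X201 ^~ w).
  apply: cvg_unique h2 => //.
  rewrite (_ : (fun n => _) = (fun n => (\prod_(i < n) (if enat_gt i (N w) then X i w else 1)) *
      (\prod_(i < n) (if enat_gt i (N w) then X i w else 1)))%R).
    by rewrite expr2; exact: cvgM.
  apply/funext => n; rewrite -expr2 -prodrXl; apply: eq_bigr => i _.
  by case: ifP; rewrite ?expr1n.
have EV2 : \int[Q]_w (V w ^+ 2)%:E = (genfun p (second_moment01 nu))%:E.
  under eq_integral => w _ do rewrite V2E.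
  apply: (eprod_mean (X := fun i w => (X i w ^+ 2)%R)) => //.
  move=> k n A mA.
  have mB i : measurable ((fun x : R => x ^+ 2)%R @^-1` A i).
    by apply: preimage_measurable => //; exact: measurable_funX.
  exact: (fac k n _ mB).
have [y yE y01] := integral_itv01_fin Q mY Y01.
have V201 w : (0 <= V w ^+ 2 <= 1)%R.
  by have /andP[a b] := V01 w; rewrite exprn_ge0//= exprn_ile1.
have Y201 w : (0 <= Y w ^+ 2 <= 1)%R.
  by have /andP[a b] := Y01 w; rewrite exprn_ge0//= exprn_ile1.
have mY2 : measurable_fun setT (fun w => Y w ^+ 2)%R by exact: measurable_funX.
have mV2 : measurable_fun setT (fun w => V w ^+ 2)%R by exact: measurable_funX.
have [y2 y2E y201] := integral_itv01_fin Q mY2 Y201.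
split; first exact: law_prob01 lY Y01.
- rewrite /mean01 /Rintegral (law_integral lY mY Y01 (@measurable_id _ _ setT)); last first.
    by move=> x /andP[].
  rewrite yE/=.
  (* The relation between [Y] and [V] is integrated free of subtraction, so that additivity for
     nonnegative functions applies; the second moment below is treated in the same way. *)
  have : \int[Q]_w ((Y w)%:E + (V w)%:E) = 1.
    rewrite (eq_integral (fun=> 1)); first by rewrite integral_cst//= mul1e probability_setT.
    by move=> w _; rewrite -EFinD subrK.
  rewrite ge0_integralD//; last 4 first.
  - by move=> w _; rewrite lee_fin; have /andP[] := Y01 w.
  - exact/measurable_EFinP.
  - by move=> w _; rewrite lee_fin; have /andP[] := V01 w.
  - exact/measurable_EFinP.
  by rewrite yE EV -EFinD => -[h]; lra.
- rewrite /second_moment01 /Rintegral (@law_integral _ _ _ _ _ (fun x => x ^+ 2)%R lY mY Y01); last 2 first.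
  + exact: measurable_funX.
  + by move=> x _; exact: sqr_ge0.
  rewrite y2E/=.
  have : \int[Q]_w ((Y w ^+ 2)%:E + ((V w)%:E + (V w)%:E)) = \int[Q]_w (1 + (V w ^+ 2)%:E).
    by apply: eq_integral => w _; rewrite -!EFinD; congr EFin; rewrite /Y; ring.
  rewrite !ge0_integralD//.
  all: try by [exact/measurable_EFinP | move=> w _; rewrite ?adde_ge0// lee_fin;
    have /andP[] := V01 w; have /andP[] := V201 w; have /andP[] := Y201 w].
  rewrite y2E EV EV2 integral_cst//= mul1e probability_setT -!EFinD => -[h].
  lra.
  by apply: emeasurable_funD; exact/measurable_EFinP.
Qed.

End moments.

(** * The generating function and the second-moment recursion *)

Section power_series.
Context {R : realType}.

(** A convex power lies above its tangent at [K]. *)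
Lemma bernoulli_exprn (K L : R) i : 0 <= K <= L ->
  K ^+ i.+1 + i.+1%:R * K ^+ i * (L - K) <= L ^+ i.+1.
Proof.
move=> /andP[K0 KL]; elim: i => [|i IH]; first by rewrite expr0 !expr1; lra.
rewrite [leRHS]exprS; apply: le_trans (ler_wpM2l (le_trans K0 KL) IH).
rewrite -subr_ge0 -[i.+2%:R]natr1 !exprS.
have -> : L * (K * K ^+ i + i.+1%:R * K ^+ i * (L - K)) -
  (K * (K * K ^+ i) + (i.+1%:R + 1) * (K * K ^+ i) * (L - K)) =
  i.+1%:R * K ^+ i * (L - K) ^+ 2 by ring.
by apply: mulr_ge0; [apply: mulr_ge0 => //; exact: exprn_ge0|exact: sqr_ge0].
Qed.

(** By [bernoulli_exprn], [(i+1) * K^i] is at most [L^(i+1) / (L - K)]: the derived series at [K] is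
    dominated by the original one at [L]. *)
Lemma pseries_diffs_cvg (c : nat -> R) (K L : R) : (forall i, 0 <= c i) ->
  0 <= K < L -> cvgn (pseries c L) -> cvgn (pseries (pseries_diffs c) K).
Proof.
move=> c0 /andP[K0 KL] cL.
have LK : 0 < L - K by rewrite subr_gt0.
have L0 : 0 <= L by exact: le_trans (ltW KL).
apply: (@series_le_cvg _ _ (fun i => (L - K)^-1 * (c i.+1 * L ^+ i.+1))).
- by move=> i; rewrite /pseries_diffs !mulr_ge0// exprn_ge0.
- by move=> i; rewrite !mulr_ge0 ?invr_ge0 ?(ltW LK) ?exprn_ge0.
- move=> i; rewrite /pseries_diffs ler_pdivlMl//=.
  rewrite [leLHS](_ : _ = c i.+1 * (i.+1%:R * K ^+ i * (L - K))); last ring.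
  have KL' : 0 <= K <= L by rewrite K0 ltW.
  rewrite ler_wpM2l// (le_trans _ (bernoulli_exprn i KL'))//.
  by rewrite lerDr exprn_ge0.
- have -> : series (fun i => (L - K)^-1 * (c i.+1 * L ^+ i.+1)) =
      (fun n => (L - K)^-1 * (pseries c L n.+1 - c 0%N)).
    apply/funext => n; rewrite /pseries /series/= -mulr_sumr; congr (_ * _).
    by rewrite big_nat_recl//= expr0 mulr1 addrAC subrr add0r.
  apply/cvg_ex; exists ((L - K)^-1 * (limn (pseries c L) - c 0%N)).
  apply: cvgM; first exact: cvg_cst.
  apply: cvgB; last exact: cvg_cst.
  by rewrite (@cvg_shiftS _ (pseries c L)).
Qed.

End power_series.

(** * Derivative and tangents of the generating function *)

Section genfun_derivative.
Context {R : realType} (p : probability enat R).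
Let c k := fine (p [set Some k]).

Let c_ge0 k : 0 <= c k. Proof. exact: fine_ge0. Qed.

Lemma pseries_genfun_cvg (s : R) : 0 <= s < 1 -> pseries c s @ \oo --> genfun p s.
Proof.
move=> /andP[s0 s1]; have s01 : 0 <= s <= 1 by rewrite s0 ltW.
pose a i := ((epow s (enat_of i))%:E * p [set enat_of i])%E.
have a0 i : (0 <= a i)%E.
  by rewrite mule_ge0// lee_fin; have /andP[] := epow_itv01 (enat_of i) s01.
have : (\sum_(0 <= i < n.+1) a i)%E @[n --> \oo] --> (genfun p s)%:E.
  rewrite genfun_sum// (@cvg_shiftS _ (fun n => \sum_(0 <= i < n) a i)%E).
  by apply: is_cvg_nneseries.
rewrite (_ : (fun n => _) = EFin \o pseries c s); first by move/fine_cvgP => [].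
(* The term of index 0 belongs to N infinite and vanishes because [s < 1]; the others form the power
   series, shifted by one. *)
apply/funext => n; rewrite big_nat_recl// {1}/a /= (lt_eqF s1) mul0e add0e.
rewrite /pseries/series/= -sumEFin; apply: eq_bigr => i _.
by rewrite /a /c /= EFinM fineK ?fin_num_measure// muleC.
Qed.

Lemma is_derive_genfun (s : R) : 0 < s < 1 ->
  is_derive s (1 : R) (genfun p) (limn (pseries (pseries_diffs c) s)).
Proof.
move=> /andP[s0 s1].
have cv t : 0 <= t < 1 -> cvgn (pseries c t).
  by move=> t01; apply/cvg_ex; exists (genfun p t); exact: pseries_genfun_cvg.
apply: (@near_eq_is_derive _ _ _ (fun x => limn (pseries c x))).
  near=> t; apply/cvg_lim => //; apply: pseries_genfun_cvg; apply/andP; split.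
    by apply: ltW; near: t; exact: lt_nbhsr.
  by near: t; exact: lt_nbhsl.
have cd0 k : 0 <= pseries_diffs c k by rewrite mulr_ge0.
(* Termwise differentiation at [s] asks that the series and its first two derived series converge at
   some [K > s]. Each derivation costs a gap, hence the chain [s < K < L < M < 1]. *)
pose K := (s + 1) / 2; pose L := (K + 1) / 2; pose M := (L + 1) / 2.
have K01 : 0 <= K < L by rewrite /L /K; lra.
have L01 : 0 <= L < M by rewrite /M /L /K; lra.
have M01 : 0 <= M < 1 by rewrite /M /L /K; lra.
have dL : cvgn (pseries (pseries_diffs c) L) by apply: pseries_diffs_cvg L01 _ => //; exact: cv.
apply: (@pseries_snd_diffs _ _ K).
- by apply: cv; rewrite /K; lra.
- apply: (@pseries_diffs_cvg R c K M) => //; [rewrite /M /L /K; lra|exact: cv].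
- exact: pseries_diffs_cvg K01 dL.
- by rewrite !ger0_norm /K; lra.
Unshelve. all: by end_near. Qed.

(** For a convex function the chord slope from [r] to [s] is at most the difference quotients at
    points of the chord nearer to [s], hence at most the derivative at [s]. *)
Lemma genfun_tangent (s r : R) :
  strictly_convex_on `[0, 1[ (genfun p) -> 0 < s < 1 -> 0 <= r < s ->
  derive1 (genfun p) s <= 1 -> genfun p s - genfun p r <= s - r.
Proof.
set H := genfun p => Hc s01 rs D1.
have [dH _] := is_derive_genfun s01.
have cv : (fun h => h^-1 *: ((H \o shift s) (h *: 1) - H s)) @ 0^' --> 'D_1 H s by exact: dH.
(* The derivative is read along [s + (r - s)/(n+2)]; the shift by 2 keeps the convex weight
   [1/(n+2)] strictly below 1. *)
move/cvgr_dnbhsP : cv => /(_ (fun n => (r - s) * n.+2%:R^-1)) cv.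
have {}cv : ((r - s) * n.+2%:R^-1)^-1 *: (H ((r - s) * n.+2%:R^-1 *: 1 + s) - H s)
    @[n --> \oo] --> 'D_1 H s.
  apply: cv; split.
    by move=> n; rewrite mulf_neq0// ?invr_eq0 ?pnatr_eq0//; lra.
  rewrite -[X in _ --> X](mulr0 (r - s)); apply: cvgM; first exact: cvg_cst.
  by have := @cvg_harmonic R; rewrite -(@cvg_shiftS _ (fun n => n.+1%:R^-1 : R)).
have : (H r - H s) / (r - s) <= 'D_1 H s.
  rewrite -(cvg_lim _ cv)//; apply: limr_ge; first exact: cvgP cv.
  near=> n.
  pose t : R := n.+2%:R^-1.
  have t01 : 0 < t < 1 by rewrite invr_gt0 ltr0n/= invf_lt1// ltr1n.
  have := Hc r s t; rewrite /= !in_itv/= => /(_ _ _ _ t01).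
  move=> /(_ ltac:(lra) ltac:(lra) ltac:(apply/eqP; lra)).
  rewrite -/t (_ : t * r + (1 - t) * s = (r - s) * t + s); last ring.
  rewrite -[_ *: 1]/(_ * 1) mulr1 -[_^-1 *: _]/(_^-1 * _) -/t.
  set H' := H ((r - s) * t + s) => h.
  have rs0 : r - s != 0 by lra.
  have t0 : t != 0 by lra.
  rewrite (_ : _ / _ = ((s - r) * t)^-1 * (t * (H s - H r))); last by field; rewrite ?t0 //; lra.
  rewrite (_ : _ * (H' - H s) = ((s - r) * t)^-1 * (H s - H')); last by field; rewrite ?t0 //; lra.
  rewrite ler_wpM2l ?invr_ge0 ?mulr_ge0//; lra.
rewrite -derive1E => /le_trans /(_ D1).
have rs0 : 0 < s - r by lra.
rewrite -opprB -[in X in _ / X]opprB invrN mulrNN ler_pdivrMr// mul1r.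
exact.
Unshelve. all: by end_near. Qed.

End genfun_derivative.

(** * The deterministic recursion for the moments *)

Section recursion.
Context {R : realType} (H : R -> R) (mu : R).
Hypothesis H_conv : strictly_convex_on `[0, 1[ H.
Hypothesis mu01 : 0 < mu < 1.
Hypothesis H_nd : forall s t : R, 0 <= s -> s <= t -> t <= 1 -> H s <= H t.
Hypothesis H_tangent : forall r : R, 0 <= r < mu -> H mu - H r <= mu - r.

Let conv (x y t : R) : 0 <= x < 1 -> 0 <= y < 1 -> x != y -> 0 < t < 1 ->
  H (t * x + (1 - t) * y) < t * H x + (1 - t) * H y.
Proof. by move=> x01 y01 xy t01; apply: H_conv => //=; rewrite in_itv. Qed.

(** The tangent bound becomes strict through the midpoint [z] of [r] and [mu]: strict convexity puts
    [H z] below the chord, and the bound holds at [z]. *)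
Lemma chord_lt (r : R) : 0 <= r < mu -> H mu - H r < mu - r.
Proof.
(* [lra] does not see section hypotheses *)
have mu01' := mu01.
move=> r0; pose z := 2^-1 * r + (1 - 2^-1) * mu.
have : H z < 2^-1 * H r + (1 - 2^-1) * H mu.
  by apply: conv; [lra|lra|by rewrite lt_eqF//; lra|lra].
have : H mu - H z <= mu - z by apply: H_tangent; rewrite /z; lra.
by rewrite /z; lra.
Qed.

(** By convexity the chord from [x] to [y] is no steeper than the chord from [x] to [mu], whose
    slope [chord_lt] bounds. *)
Lemma chord_lip (x y : R) : 0 <= x <= y -> y <= mu -> H y - H x <= y - x.
Proof.
have mu01' := mu01.
move=> /andP[x0 xy] ymu.
have [->|yx] := eqVneq x y; first by rewrite !subrr.
have {yx} xy' : x < y by rewrite lt_neqAle yx.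
have [->|ymu'] := eqVneq y mu; first by apply: ltW; apply: chord_lt; lra.
have {ymu'} {}ymu : y < mu by rewrite lt_neqAle ymu'.
have xm : 0 < mu - x by lra.
pose t := (mu - y) / (mu - x).
have tE : t * (mu - x) = mu - y by rewrite /t divfK//; lra.
have t01 : 0 < t < 1.
  apply/andP; split; first by rewrite /t divr_gt0//; lra.
  by rewrite /t ltr_pdivrMr//; lra.
have yE : y = t * x + (1 - t) * mu.
  have -> : t * x + (1 - t) * mu = mu - t * (mu - x) by ring.
  by rewrite tE; ring.
have h : H y < t * H x + (1 - t) * H mu.
  by rewrite {1}yE; apply: conv => //; [lra|lra|by rewrite lt_eqF//; lra].
have hm : (1 - t) * (H mu - H x) <= (1 - t) * (mu - x).
  by rewrite ler_wpM2l//; [lra|apply: ltW; apply: chord_lt; lra].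
have : (1 - t) * (mu - x) = y - x by rewrite mulrBl tE; ring.
have : (1 - t) * (H mu - H x) = (1 - t) * H mu + t * H x - H x by ring.
lra.
Qed.

Hypothesis H_root : H mu + mu = 1.

Lemma fixpoint_mean (m : R) : 0 <= m <= 1 -> H 1 = 1 -> m = 1 - H m -> m = mu.
Proof.
have mu01' := mu01; have H_root' := H_root.
move=> m01 H1 mE.
have [mm|mm|//] := ltgtP m mu.
  have : H m <= H mu by apply: H_nd; lra.
  by lra.
have : H mu <= H m by apply: H_nd; lra.
by lra.
Qed.

(** Since [H mu + mu = 1], the equation says [H mu - H r = mu - r], which [chord_lt] excludes below
    [mu]. *)
Lemma fixpoint_second_moment (r : R) : 0 <= r <= mu -> r = 1 - 2 * H mu + H r -> r = mu.
Proof.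
have mu01' := mu01; have H_root' := H_root.
move=> r0 rE; apply/eqP; rewrite eq_le; apply/andP; split; first lra.
by rewrite leNgt; apply/negP => rm; have := @chord_lt r; lra.
Qed.

(** The upper bound comes from [r n <= m n]. From below, [r] climbs by a fixed amount per step until
    it reaches [mu - e], and then stays above this level. *)
Lemma second_moment_cvg (m r : nat -> R) :
  (forall n, 0 <= r n <= m n) -> (forall n, m n <= 1) ->
  (forall n, r n.+1 = 1 - 2 * H (m n) + H (r n)) ->
  m @ \oo --> mu -> H (m n) @[n --> \oo] --> H mu -> r @ \oo --> mu.
Proof.
have mu01' := mu01; have H_root' := H_root.
move=> rm m1 rE mmu Hm; apply/cvgrPdist_le => e0 e0_gt0.
(* The cap at [mu] keeps [mu - e] nonnegative. *)
pose e := Num.min e0 mu.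
have ee0 : e <= e0 by rewrite /e ge_min lexx.
have emu : e <= mu by rewrite /e ge_min lexx orbT.
have e_gt0 : 0 < e by rewrite /e lt_min e0_gt0; lra.
(* The gap in the strict chord inequality over [[mu - e, mu]]. The error in [H (m n)] enters the
   recursion twice, so an error of at most [de / 4] leaves a gain of [de / 2]. *)
pose de := e - (H mu - H (mu - e)).
have de_gt0 : 0 < de by rewrite /de; have := @chord_lt (mu - e); lra.
have He : H (mu - e) <= H mu by apply: H_nd; lra.
have [N _ HN] : \forall n \near \oo, `|H mu - H (m n)| <= de / 4.
  by move/cvgrPdist_le : Hm; apply; lra.
have step n : (N <= n)%N -> Num.min (r n + de / 2) (mu - e) <= r n.+1.
  move=> Nn; rewrite ge_min rE.
  have := HN n Nn; rewrite /= ler_norml => hn.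
  have rn := rm n; have mn := m1 n.
  have [rmu|rmu] := leP mu (r n).
    have : H mu <= H (r n) by apply: H_nd; lra.
    by rewrite /de in hn * => hh; apply/orP; right; lra.
  have [re|re] := leP (mu - e) (r n).
    have : H (mu - e) <= H (r n) by apply: H_nd; lra.
    by rewrite /de in hn * => hh; apply/orP; right; lra.
  have : H (mu - e) - H (r n) <= (mu - e) - r n by apply: chord_lip; lra.
  by rewrite /de in hn * => hh; apply/orP; left; lra.
have ind k : Num.min (k%:R * (de / 2)) (mu - e) <= r (N + k)%N.
  elim: k => [|k IH].
    by rewrite mul0r ge_min; have /andP[-> _] := rm (N + 0)%N.
  rewrite addnS; apply: le_trans (step _ (leq_addr _ _)).
  rewrite le_min !ge_min lexx orbT andbT -natr1 mulrDl mul1r lerD2r.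
  by move: IH; rewrite ge_min; case/orP => h; apply/orP; [left|right; lra].
have {}HN : \forall n \near \oo, mu - e <= r n.
  (* After this many steps the linear lower bound has passed [mu], so either alternative of [ind]
     gives [mu - e <= r n]. *)
  exists (N + (Num.truncn (mu / (de / 2))).+1)%N => // n /= nN.
  have /subnKC nE : (N <= n)%N by apply: leq_trans nN; exact: leq_addr.
  have := ind (n - N)%N; rewrite nE ge_min => /orP[|//].
  have : mu <= (n - N)%:R * (de / 2).
    rewrite -ler_pdivrMr; last by lra.
    apply: ltW; apply: lt_le_trans (truncnS_gt _) _.
    by rewrite ler_nat leq_subRL// (leq_trans _ nN)// leq_addr.
  by lra.
near=> n.
have h1 : mu - e <= r n by near: n.
have h2 : `|mu - m n| <= e0 by near: n; move/cvgrPdist_le : mmu; apply.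
by move: h2; have := rm n; rewrite !ler_norml; lra.
Unshelve. all: by end_near. Qed.

End recursion.

(** * Weak convergence to a Bernoulli law *)

Section weak_convergence.
Context {R : realType}.
Local Notation I01 := (`[0%R, 1%R]%classic : set R).

Lemma bounded_integrable01 (nu : probability R R) (f : R -> R) (M : R) :
  measurable_fun I01 f -> (forall x, 0 <= x <= 1 -> `|f x| <= M) ->
  nu.-integrable I01 (EFin \o f).
Proof.
move=> mf fM; apply: measurable_bounded_integrable => //.
  by rewrite (le_lt_trans (probability_le1 _ _))// ltry.
exists M; split; first exact: num_real.
by move=> N MN x /=; rewrite in_itv/= => /fM /le_trans; apply; exact: ltW.
Qed.

Lemma Rintegral_quadratic (nu : probability R R) (a b c : R) : prob01 nu ->
  nu.-integrable I01 (EFin \o (fun x => a + b * x + c * x ^+ 2)) /\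
  (\int[nu]_(x in I01) (a + b * x + c * x ^+ 2) =
    a + b * mean01 nu + c * second_moment01 nu)%R.
Proof.
move=> nu01.
have i0 : nu.-integrable I01 (EFin \o cst a).
  by apply: (@bounded_integrable01 _ _ `|a|).
have i1 : nu.-integrable I01 (EFin \o id).
  by apply: (@bounded_integrable01 _ _ 1) => // x x01; rewrite ger0_norm; lra.
have i2 : nu.-integrable I01 (EFin \o (fun x => x ^+ 2)).
  apply: (@bounded_integrable01 _ _ 1); first exact: measurable_funX.
  by move=> x /andP[x0 x1]; rewrite ger0_norm ?exprn_ge0// exprn_ile1.
have mI : measurable I01 by exact: measurable_itv.
have i1' : nu.-integrable I01 (EFin \o (fun x => b * x)).
  by have := integrableZl mI b i1.
have i2' : nu.-integrable I01 (EFin \o (fun x => c * x ^+ 2)).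
  by have := integrableZl mI c i2.
have i01 : nu.-integrable I01 (EFin \o (fun x => a + b * x)).
  by have := integrableD mI i0 i1'.
split; first by have := integrableD mI i01 i2'.
rewrite RintegralD// RintegralD// RintegralZl// RintegralZl//.
have nuI : nu I01 = 1%E by exact: nu01.
by rewrite Rintegral_cst//= nuI mulr1.
Qed.

Lemma moments01_itv (nu : probability R R) : prob01 nu ->
  0 <= second_moment01 nu <= mean01 nu /\ mean01 nu <= 1.
Proof.
move=> nu01; have mI : measurable I01 by exact: measurable_itv.
have [i2 E2] := Rintegral_quadratic 0 0 1 nu01.
have [i1 E1] := Rintegral_quadratic 0 1 0 nu01.
have [i0 E0] := Rintegral_quadratic 1 0 0 nu01.
rewrite !(mul0r, mul1r, add0r, addr0) in E0 E1 E2.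
split; first (apply/andP; split).
- rewrite /second_moment01; apply: Rintegral_ge0 => x _; exact: sqr_ge0.
- rewrite -E1 -E2; apply: (le_Rintegral mI i2 i1) => x; rewrite /= in_itv/= => /andP[x0 x1].
  by rewrite !(mul0r, mul1r, add0r, addr0) expr2 ler_piMr.
- rewrite -[leRHS]E0 -E1; apply: (le_Rintegral mI i1 i0) => x; rewrite /= in_itv/= => /andP[x0 x1].
  by rewrite !(mul0r, mul1r, add0r, addr0).
Qed.

(** Near the endpoints continuity leaves an error [e] and terms of order [x - x ^+ 2]; in between
    [x - x ^+ 2] is bounded below, so a large multiple of it covers everything. *)
Lemma chord_approx (f : R -> R) (e : R) : {within `[0, 1], continuous f} -> 0 < e ->
  exists K, forall x, 0 <= x <= 1 ->
    `|f x - ((1 - x) * f 0 + x * f 1)| <= e + K * (x - x ^+ 2).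
Proof.
move=> cf e0.
have [M M0 fM] : exists2 M, 0 <= M & forall x, 0 <= x <= 1 -> `|f x| <= M.
  have /compact_bounded[M [_ mrt]] := continuous_compact cf (@segment_compact R 0 1).
  exists (`|M| + 1); first by rewrite addr_ge0.
  move=> x x01; apply: (mrt (`|M| + 1)).
    by rewrite (le_lt_trans (ler_norm _))// ltrDl.
  by exists x => //; rewrite /= in_itv.
have f0M : `|f 0| <= M by apply: fM; lra.
have f1M : `|f 1| <= M by apply: fM; lra.
have [_ f0 f1] := (continuous_within_itvP f (@ltr01 R)).1 cf.
have [de0 /= de0_gt0 h0] : \forall x \near 0^'+, `|f 0 - f x| <= e by move/cvgrPdist_le : f0; apply.
have [de1 /= de1_gt0 h1] : \forall x \near 1^'-, `|f 1 - f x| <= e by move/cvgrPdist_le : f1; apply.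
pose de := Num.min (Num.min de0 de1) 2^-1.
have de_gt0 : 0 < de by rewrite /de !lt_min de0_gt0 de1_gt0; lra.
have [dd0 dd1 dd2] : [/\ de <= de0, de <= de1 & de <= 2^-1].
  by rewrite /de !ge_min !lexx !orbT.
(* The first summand serves within [de] of an endpoint. The second serves in the middle, where
   [x - x ^+ 2 >= de / 2] and the difference is at most [2 * M]. *)
exists (4 * M + 4 * M / de) => x x01.
have [x0 x1] := andP x01.
have Md : 0 <= M / de by rewrite divr_ge0// ltW.
have xx0 : 0 <= x - x ^+ 2.
  by rewrite (_ : _ - _ = x * (1 - x)) ?mulr_ge0//; [lra|ring].
have KE : (4 * M + 4 * M / de) * (x - x ^+ 2) = 4 * (M * (x - x ^+ 2)) + 4 * (M / de * (x - x ^+ 2)) by ring.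
have Mx0 : 0 <= M * (x - x ^+ 2) by exact: mulr_ge0.
have Mx1 : 0 <= M / de * (x - x ^+ 2) by exact: mulr_ge0.
have fxM := fM x x01.
have [xd|xd] := ltP x de.
  have fx : `|f 0 - f x| <= e.
    have [->|xn0] := eqVneq x 0; first by rewrite subrr normr0 ltW.
    have x_gt0 : 0 < x by rewrite lt_neqAle eq_sym xn0.
    by apply: h0 => //=; rewrite sub0r normrN ger0_norm//; exact: lt_le_trans dd0.
  have hx : x * M <= 2 * (M * (x - x ^+ 2)).
    rewrite (_ : 2 * _ = x * M * (2 * (1 - x))); last ring.
    by rewrite ler_peMr ?mulr_ge0//; lra.
  have xf0 : `|x * f 0| <= x * M by rewrite normrM ger0_norm// ler_wpM2l.
  have xf1 : `|x * f 1| <= x * M by rewrite normrM ger0_norm// ler_wpM2l.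
  rewrite KE (_ : _ - _ = - (f 0 - f x) + (x * f 0 - x * f 1)); last ring.
  by move: fx xf0 xf1; rewrite !ler_norml; lra.
have [xd1|xd1] := ltP (1 - x) de.
  have fx : `|f 1 - f x| <= e.
    have [->|xn1] := eqVneq x 1; first by rewrite subrr normr0 ltW.
    have x_lt1 : x < 1 by rewrite lt_neqAle xn1.
    by apply: h1 => //=; rewrite ger0_norm ?subr_ge0//; exact: lt_le_trans dd1.
  have hx : (1 - x) * M <= 2 * (M * (x - x ^+ 2)).
    rewrite (_ : 2 * _ = (1 - x) * M * (2 * x)); last ring.
    by rewrite ler_peMr ?mulr_ge0//; lra.
  have x10 : 0 <= 1 - x by lra.
  have xf0 : `|(1 - x) * f 0| <= (1 - x) * M by rewrite normrM (ger0_norm x10) ler_wpM2l.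
  have xf1 : `|(1 - x) * f 1| <= (1 - x) * M by rewrite normrM (ger0_norm x10) ler_wpM2l.
  rewrite KE (_ : f x - _ = - (f 1 - f x) + ((1 - x) * f 1 - (1 - x) * f 0)); last ring.
  by move: fx xf0 xf1; rewrite !ler_norml; lra.
have hx : M * 2 <= 4 * (M / de * (x - x ^+ 2)).
  have : de * 2^-1 <= x - x ^+ 2.
    rewrite (_ : x - _ = x * (1 - x)); last ring.
    have [xh|xh] := leP x 2^-1.
      by apply: ler_pM => //; lra.
    by rewrite mulrC; apply: ler_pM => //; lra.
  move=> hh.
  have : M / de * (de * 2^-1) <= M / de * (x - x ^+ 2) by exact: ler_wpM2l.
  have -> : M / de * (de * 2^-1) = M * 2^-1 by rewrite mulrA divfK// gt_eqF.
  by lra.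
have xf0 : `|(1 - x) * f 0| <= (1 - x) * M.
  by rewrite normrM (ger0_norm (_ : 0 <= 1 - x)) ?ler_wpM2l//; lra.
have xf1 : `|x * f 1| <= x * M by rewrite normrM ger0_norm// ler_wpM2l.
rewrite KE; move: fxM xf0 xf1; rewrite !ler_norml; lra.
Qed.

(** Integration of [chord_approx]: [K] does not depend on the law, which enters the error only
    through E[X(1-X)]. *)
Lemma Rintegral_chord (f : R -> R) (e : R) : {within `[0, 1], continuous f} -> 0 < e ->
  exists K, forall nu : probability R R, prob01 nu ->
    `|\int[nu]_(x in `[0, 1]) f x - ((1 - mean01 nu) * f 0 + mean01 nu * f 1)| <=
      e + K * (mean01 nu - second_moment01 nu).
Proof.
move=> cf e0; have [K HK] := chord_approx cf e0.
exists K => nu nu01; have mI : measurable I01 by exact: measurable_itv.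
have intf : nu.-integrable I01 (EFin \o f).
  have /compact_bounded[M [_ mrt]] := continuous_compact cf (@segment_compact R 0 1).
  apply: (@bounded_integrable01 _ _ (`|M| + 1)).
    exact: subspace_continuous_measurable_fun.
  move=> x x01; apply: (mrt (`|M| + 1)).
    by rewrite (le_lt_trans (ler_norm _))// ltrDl.
  by exists x => //; rewrite /= in_itv.
have [iu Eu] := Rintegral_quadratic (f 0 + e) (f 1 - f 0 + K) (- K) nu01.
have [il El] := Rintegral_quadratic (f 0 - e) (f 1 - f 0 - K) K nu01.
have hu : \int[nu]_(x in I01) f x <= f 0 + e + (f 1 - f 0 + K) * mean01 nu - K * second_moment01 nu.
  rewrite -mulNr -Eu; apply: (le_Rintegral mI intf iu) => x; rewrite /= in_itv/= => /HK.
  by rewrite ler_norml; lra.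
have hl : f 0 - e + (f 1 - f 0 - K) * mean01 nu + K * second_moment01 nu <= \int[nu]_(x in I01) f x.
  rewrite -El; apply: (le_Rintegral mI il intf) => x; rewrite /= in_itv/= => /HK.
  by rewrite ler_norml; lra.
by rewrite ler_norml; lra.
Qed.

Lemma weakly_cvg01_bernoulli (nu_ : nat -> probability R R) (pi : probability R R) :
  (forall n, prob01 (nu_ n)) -> prob01 pi -> second_moment01 pi = mean01 pi ->
  mean01 (nu_ n) @[n --> \oo] --> mean01 pi ->
  second_moment01 (nu_ n) @[n --> \oo] --> mean01 pi ->
  weakly_cvg01 nu_ pi.
Proof.
move=> nu01 pi01 rpi mcvg rcvg f cf.
set L := \int[pi]_(x in `[0, 1]) f x.
(* For [pi] the term in [K] is zero, so its integral equals the chord value to within every [e]. *)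
have LE : L = (1 - mean01 pi) * f 0 + mean01 pi * f 1.
  apply/eqP; rewrite -subr_eq0 -normr_le0; apply/ler_addgt0Pr => e e0.
  have [K /(_ pi pi01)] := Rintegral_chord cf e0.
  by rewrite rpi subrr mulr0 addr0 add0r.
apply/cvgrPdist_le => e e0.
have e40 : 0 < e / 4 by lra.
have [K HK] := Rintegral_chord cf e40.
have c1 : ((1 - mean01 (nu_ n)) * f 0 + mean01 (nu_ n) * f 1) @[n --> \oo] --> L.
  rewrite LE; apply: cvgD; apply: cvgM; try exact: cvg_cst; last exact: mcvg.
  by apply: cvgB; [exact: cvg_cst|exact: mcvg].
have c2 : (K * (mean01 (nu_ n) - second_moment01 (nu_ n))) @[n --> \oo] --> 0.
  rewrite -(mulr0 K) -(subrr (mean01 pi)); apply: cvgM; first exact: cvg_cst.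
  exact: cvgB.
near=> n.
have h1 : `|L - ((1 - mean01 (nu_ n)) * f 0 + mean01 (nu_ n) * f 1)| <= e / 4.
  by near: n; move/cvgrPdist_le : c1; apply.
have h2 : `|0 - K * (mean01 (nu_ n) - second_moment01 (nu_ n))| <= e / 4.
  by near: n; move/cvgrPdist_le : c2; apply.
by have := HK _ (nu01 n); move: h1 h2; rewrite !ler_norml; lra.
Unshelve. all: by end_near. Qed.

End weak_convergence.

(** * The law of the root as a fixed point, and its basin *)

Lemma tree_solution_RDE_image (R : realType) (p : probability enat R)
    d (T : measurableType d) (P : probability T R)
    (N : tree -> {RV P >-> enat}) (hN : iid_copies p N)
    (C : tree -> {RV P >-> R}) (hC : tree_solution N C) :
  RDE_image p (distribution P (C [::])) (distribution P (C [::])).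
Proof.
(* The root variable of N and the daughters of the root realise the definition of the image law. *)
exists d, T, P, (N [::]), (fun i => C [:: i]); split.
- exact: hN.2.
- move=> i; split; first exact: sol_law hC _ _.
  by move=> w; exact: sol_in01 hC _ _.
- move=> s A us _ mA.
  have := @sol_indep _ _ _ _ _ _ hC 1%N [seq [:: i] | i <- s] (fun u => A (head 0%N u)).
  rewrite big_map/= map_inj_uniq; last by move=> i j [].
  move=> <- //.
  + congr (P _); apply/seteqP; split => w /= h u.
      by move=> /= /mapP[i si ->]; exact: h.
    by move=> /= us'; apply: (h [:: u]); rewrite /= map_f.
  + by move=> u /mapP[i _ ->].
- move=> F G sF sG; apply: (sol_indepN hC (n := 1%N)).
  + apply: sub_sigma_algebra2 sF => _ [i _ [B mB <-]].
    by exists [:: i] => //; exists B.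
  + apply: sub_sigma_algebra2 sG => _ [i _ [B mB <-]].
    by exists [::] => //; exists B.
- have mY : measurable_fun setT (fun w => 1 - eprod (N [::] w) (fun i => C [:: i] w)).
    apply: measurable_funB => //; apply: measurable_eprod => // i w.
    exact: sol_in01 hC _ _.
  move=> A mA; have [Z [mZ Z0 subZ]] := sol_RDE hC [::].
  have eqZ w : ~ Z w -> C [::] w = 1 - eprod (N [::] w) (fun i => C [:: i] w).
    by move=> nZ; apply: contrapT => h; apply: nZ; apply: subZ.
  rewrite /distribution /pushforward.
  (* The equation at the root holds only almost everywhere; the null set [Z] is removed from both
     events before they are compared. *)
  have PZ B : measurable B -> P B = P (B `\` Z).
    move=> mB; have PBZ : P (B `&` Z) = 0%E.
      by apply: (subset_measure0 (B := Z)) => //; exact: measurableI.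
    rewrite measureD//=; last by rewrite (le_lt_trans (probability_le1 _ mB))// ltry.
    by rewrite PBZ sube0.
  rewrite PZ; last exact: preimage_measurable.
  rewrite [RHS]PZ; last exact: preimage_measurable.
  by congr (P _); apply/seteqP; split => w /= [h nZ]; split => //; move: h; rewrite eqZ.
Qed.

Theorem theorem5p4 (R : realType) (p : probability enat R)
    (hp : offspring_law p)
    (hconv : strictly_convex_on `[0, 1[ (genfun p))
    (mu1 : R) (hmu1 : 0 < mu1 < 1) (hroot : genfun p mu1 + mu1 = 1)
    (d : measure_display) (T : measurableType d) (P : probability T R)
    (N : tree -> {RV P >-> enat}) (hN : iid_copies p N)
    (C : tree -> {RV P >-> R}) (hC : tree_solution N C)
    (hendo : endogenous N C)
    (hder : derive1 (genfun p) mu1 <= 1) :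
  basin p (distribution P (C [::])) =
    [set nu | prob01 nu /\ moment_basin p mu1 (mean01 nu)].
Proof.
set pi := distribution P (C [::]).
(* Since [pi] is its own image, the moment formulas become equations for its moments. *)
have [pi01 mE rE] := RDE_image_moments (tree_solution_RDE_image hN hC).
rewrite -/pi in pi01 mE rE.
have tangent r : 0 <= r < mu1 -> genfun p mu1 - genfun p r <= mu1 - r.
  by move=> r0; exact: genfun_tangent.
have nd := @genfun_nd R p.
have [pi_rm pi_m1] := moments01_itv pi01.
have m_pi : mean01 pi = mu1.
  by apply: (fixpoint_mean hmu1 nd hroot _ (genfun1 p)) => //; lra.
rewrite m_pi in rE pi_rm.
have r_pi : second_moment01 pi = mu1.
  exact: (fixpoint_second_moment hconv hmu1 tangent hroot).
have orbit nu : prob01 nu -> forall n,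
    [/\ prob01 (iter n (RDE_map p) nu),
     mean01 (iter n (RDE_map p) nu) = iter n (fun t => 1 - genfun p t) (mean01 nu) &
     second_moment01 (iter n.+1 (RDE_map p) nu) =
       1 - 2 * genfun p (mean01 (iter n (RDE_map p) nu)) +
       genfun p (second_moment01 (iter n (RDE_map p) nu))].
  move=> nu01.
  (* On laws carried by [0, 1] an image exists, so the choice in [RDE_map] is a true image and not
     the default. *)
  have step nu' : prob01 nu' -> RDE_image p nu' (RDE_map p nu').
    by move=> nu'01; apply: xgetPex; exact: RDE_image_ex.
  have all01 n : prob01 (iter n (RDE_map p) nu).
    by elim: n => // n IH; have [] := RDE_image_moments (step _ IH).
  move=> n; split; first exact: all01.
    elim: n => // n IH; have [_ + _] := RDE_image_moments (step _ (all01 n)).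
    by rewrite /= IH.
  by have [] := RDE_image_moments (step _ (all01 n)).
apply/seteqP; split => nu [nu01 h]; split => //.
  split; first by have := moments01_itv nu01; lra.
  (* Weak convergence is tested against the identity function. *)
  have cv : mean01 (iter n (RDE_map p) nu) @[n --> \oo] --> mean01 pi.
    by apply: (h idfun); apply: continuous_subspaceT => x; exact: cvg_id.
  rewrite m_pi in cv.
  rewrite (_ : (fun n => _) = fun n => mean01 (iter n (RDE_map p) nu)).
    exact: cv.
  by apply/funext => n; have [_ -> _] := orbit nu nu01 n.
have mcvg : mean01 (iter n (RDE_map p) nu) @[n --> \oo] --> mu1.
  rewrite (_ : (fun n => _) = fun n => iter n (fun t => 1 - genfun p t) (mean01 nu)).
    exact: h.2.
  by apply/funext => n; have [_ -> _] := orbit nu nu01 n.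
(* Both moments of [pi] equal [mu1]; it remains to make the second moments of the orbit converge to
   it. *)
apply: weakly_cvg01_bernoulli => //; rewrite ?m_pi//.
  by move=> n; have [] := orbit nu nu01 n.
apply: (second_moment_cvg hconv hmu1 nd tangent hroot _ _ _ mcvg).
- by move=> n; have [/moments01_itv[]] := orbit nu nu01 n.
- by move=> n; have [/moments01_itv[]] := orbit nu nu01 n.
- by move=> n; have [] := orbit nu nu01 n.
- have [dH _] := is_derive_genfun p hmu1.
  have cH : {for mu1, continuous (genfun p)}.
    by apply: differentiable_continuous; exact/derivable1_diffP.
  exact: (cvg_comp _ _ mcvg cH).
Qed.
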